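(* Let $\mathcal{V}=(\mathcal{V}_0,\otimes,I)$ be a symmetric monoidal closed category with $\mathcal{V}_0$ complete and cocomplete. Let $J:\mathcal{A}\to\mathcal{B}$ be a $\mathcal{V}$-functor between small $\mathcal{V}$-categories. The following conditions are equivalent: (a) $J$ is a $\mathcal{V}$-lax epimorphism. (b) $J$ is absolutely $\mathcal{V}$-dense. (c) $J$ is absolutely $\mathcal{V}$-codense.
   Context: For $\mathcal{A}$ a small $\mathcal{V}$-category and $\mathcal{C}$ a $\mathcal{V}$-category, $\mathcal{V}\text{-}\mathrm{Cat}[\mathcal{A},\mathcal{C}]$ is the $\mathcal{V}$-category of $\mathcal{V}$-functors, with hom-objects the ends $\int_{A\in\mathcal{A}}\mathcal{C}(FA,GA)$; $\mathcal{V}\text{-}\mathrm{Cat}[J,\mathcal{C}]$ denotes precomposition with $J$. A $\mathcal{V}$-functor $P$ is $\mathcal{V}$-fully faithful if every $P_{A,A'}:\mathcal{A}(A,A')\to\mathcal{B}(PA,PA')$ is an isomorphism in $\mathcal{V}_0$. A $\mathcal{V}$-functor $J:\mathcal{A}\to\mathcal{B}$ between small $\mathcal{V}$-categories is a $\mathcal{V}$-lax epimorphism if for every small $\mathcal{V}$-category $\mathcal{C}$ the $\mathcal{V}$-functor $\mathcal{V}\text{-}\mathrm{Cat}[J,\mathcal{C}]:\mathcal{V}\text{-}\mathrm{Cat}[\mathcal{B},\mathcal{C}]\to\mathcal{V}\text{-}\mathrm{Cat}[\mathcal{A},\mathcal{C}]$ is $\mathcal{V}$-fully faithful. Kan extensions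 are the pointwise $\mathcal{V}$-enriched ones. $J:\mathcal{A}\to\mathcal{B}$ is $\mathcal{V}$-dense if $\mathrm{Lan}_J J$ (exists and) is isomorphic to the identity $\mathcal{V}$-functor on $\mathcal{B}$ (the density comonad is isomorphic to the identity). Dually, $J$ is $\mathcal{V}$-codense if the right Kan extension $\mathrm{Ran}_J J$ is the identity on $\mathcal{B}$ (up to isomorphism). $J$ is absolutely $\mathcal{V}$-dense if it is $\mathcal{V}$-dense and $\mathrm{Lan}_J J$ is preserved by every $\mathcal{V}$-functor $F:\mathcal{B}\to\mathcal{V}$ (i.e. $F\cdot\mathrm{Lan}_J J$, with the unit whiskered by $F$, is $\mathrm{Lan}_J(F\cdot J)$). Absolutely $\mathcal{V}$-codense is the dual notion: $J$ is absolutely $\mathcal{V}$-codense if $J^{\mathrm{op}}:\mathcal{A}^{\mathrm{op}}\to\mathcal{B}^{\mathrm{op}}$ is absolutely $\mathcal{V}$-dense. *)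

(* Defs.v *)
From Stdlib Require Import ssreflect Program.Equality ClassicalEpsilon.

Set Implicit Arguments.
Unset Strict Implicit.
Unset Printing Implicit Defensive.

(* Throughout, "small" means "in Set": a category has hom-sets in Set, and it
   is small when its type of objects is in Set as well.  The type of objects is
   a parameter of the structures, so that small and large categories are
   instances of the same record. *)

Record category (O : Type) := Category {
  hom : O -> O -> Set;
  idm : forall x, hom x x;
  comp : forall x y z, hom y z -> hom x y -> hom x z;
  comp1m : forall x y (f : hom x y), comp (idm y) f = f;
  compm1 : forall x y (f : hom x y), comp f (idm x) = f;
  compA : forall x y z w (h : hom z w) (g : hom y z) (f : hom x y),
    comp (comp h g) f = comp h (comp g f)
}.

Notation "g ∘ f" := (comp g f) (at level 40, left associativity).

Definition is_iso O (C : category O) (x y : O) (f : hom C x y) : Prop :=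
  exists g : hom C y x, g ∘ f = idm C x /\ f ∘ g = idm C y.

Record functor OD OC (D : category OD) (C : category OC) := Functor {
  fob :> OD -> OC;
  fmap : forall x y, hom D x y -> hom C (fob x) (fob y);
  fmap1 : forall x, fmap (idm D x) = idm C (fob x);
  fmapM : forall x y z (g : hom D y z) (f : hom D x y),
    fmap (g ∘ f) = fmap g ∘ fmap f
}.

Section Limits.
Variables (OD OC : Type) (D : category OD) (C : category OC) (T : functor D C).

Definition is_cone (X : OC) (p : forall d, hom C X (T d)) : Prop :=
  forall d d' (u : hom D d d'), fmap T u ∘ p d = p d'.

Definition is_limit (L : OC) (p : forall d, hom C L (T d)) : Prop :=
  is_cone p /\
  forall X (q : forall d, hom C X (T d)), is_cone q ->
    exists! h : hom C X L, forall d, p d ∘ h = q d.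

Definition is_cocone (X : OC) (i : forall d, hom C (T d) X) : Prop :=
  forall d d' (u : hom D d d'), i d' ∘ fmap T u = i d.

Definition is_colimit (L : OC) (i : forall d, hom C (T d) L) : Prop :=
  is_cocone i /\
  forall X (j : forall d, hom C (T d) X), is_cocone j ->
    exists! h : hom C L X, forall d, h ∘ i d = j d.

End Limits.

Definition complete OC (C : category OC) : Prop :=
  forall (OD : Set) (D : category OD) (T : functor D C),
    exists (L : OC) (p : forall d, hom C L (T d)), is_limit p.

Definition cocomplete OC (C : category OC) : Prop :=
  forall (OD : Set) (D : category OD) (T : functor D C),
    exists (L : OC) (i : forall d, hom C (T d) L), is_colimit i.

(* Symmetric monoidal closed categories; [_ ⊗ X] is left adjoint to [ihom X]. *)
Record smcc := Smcc {
  ob :> Type;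
  base : category ob;
  tens : ob -> ob -> ob;
  tensm : forall X X' Y Y',
    hom base X X' -> hom base Y Y' -> hom base (tens X Y) (tens X' Y');
  unit : ob;
  assoc : forall X Y Z, hom base (tens (tens X Y) Z) (tens X (tens Y Z));
  assocV : forall X Y Z, hom base (tens X (tens Y Z)) (tens (tens X Y) Z);
  lun : forall X, hom base (tens unit X) X;
  lunV : forall X, hom base X (tens unit X);
  run : forall X, hom base (tens X unit) X;
  runV : forall X, hom base X (tens X unit);
  sym : forall X Y, hom base (tens X Y) (tens Y X);
  ihom : ob -> ob -> ob;
  ev : forall X Y, hom base (tens (ihom X Y) X) Y;
  curry : forall Z X Y, hom base (tens Z X) Y -> hom base Z (ihom X Y);
  tensm1 : forall X Y, tensm (idm base X) (idm base Y) = idm base (tens X Y);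
  tensmM : forall X X' X'' Y Y' Y''
      (f' : hom base X' X'') (f : hom base X X')
      (g' : hom base Y' Y'') (g : hom base Y Y'),
    tensm (f' ∘ f) (g' ∘ g) = tensm f' g' ∘ tensm f g;
  assocK : forall X Y Z,
    assocV X Y Z ∘ assoc X Y Z = idm base (tens (tens X Y) Z);
  assocVK : forall X Y Z,
    assoc X Y Z ∘ assocV X Y Z = idm base (tens X (tens Y Z));
  assocN : forall X X' Y Y' Z Z'
      (f : hom base X X') (g : hom base Y Y') (h : hom base Z Z'),
    assoc X' Y' Z' ∘ tensm (tensm f g) h =
    tensm f (tensm g h) ∘ assoc X Y Z;
  lunK : forall X, lunV X ∘ lun X = idm base (tens unit X);
  lunVK : forall X, lun X ∘ lunV X = idm base X;
  lunN : forall X Y (f : hom base X Y),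
    lun Y ∘ tensm (idm base unit) f = f ∘ lun X;
  runK : forall X, runV X ∘ run X = idm base (tens X unit);
  runVK : forall X, run X ∘ runV X = idm base X;
  runN : forall X Y (f : hom base X Y),
    run Y ∘ tensm f (idm base unit) = f ∘ run X;
  pentagon : forall W X Y Z,
    assoc W X (tens Y Z) ∘ assoc (tens W X) Y Z =
    tensm (idm base W) (assoc X Y Z) ∘ assoc W (tens X Y) Z
      ∘ tensm (assoc W X Y) (idm base Z);
  triangle : forall X Y,
    tensm (idm base X) (lun Y) ∘ assoc X unit Y = tensm (run X) (idm base Y);
  symK : forall X Y, sym Y X ∘ sym X Y = idm base (tens X Y);
  symN : forall X X' Y Y' (f : hom base X X') (g : hom base Y Y'),
    sym X' Y' ∘ tensm f g = tensm g f ∘ sym X Y;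
  hexagon : forall X Y Z,
    assoc Y Z X ∘ sym X (tens Y Z) ∘ assoc X Y Z =
    tensm (idm base Y) (sym X Z) ∘ assoc Y X Z
      ∘ tensm (sym X Y) (idm base Z);
  ev_curry : forall Z X Y (f : hom base (tens Z X) Y),
    ev X Y ∘ tensm (curry f) (idm base X) = f;
  curry_ev : forall Z X Y (g : hom base Z (ihom X Y)),
    curry (ev X Y ∘ tensm g (idm base X)) = g
}.

Arguments unit {s}.
Arguments assoc {s} X Y Z.
Arguments assocV {s} X Y Z.
Arguments lun {s} X.
Arguments lunV {s} X.
Arguments run {s} X.
Arguments runV {s} X.
Arguments sym {s} X Y.
Arguments ihom {s} X Y.
Arguments ev {s} X Y.

Notation "X ⟶ Y" := (hom (base _) X Y) (at level 60, no associativity).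
Notation "X ⊗ Y" := (tens X Y) (at level 39, left associativity).
Notation "f ⊗m g" := (tensm f g) (at level 39, left associativity).
Notation id_ X := (idm (base _) X).

Section Coherence.
Variable V : smcc.
Implicit Types X Y Z W : V.

Lemma comp_eq O (C : category O) (x y y' z : O) (g : hom C y z) (f : hom C x y)
    (g' : hom C y' z) (f' : hom C x y') : g ∘ f = g' ∘ f' ->
  forall w (h : hom C w x), g ∘ (f ∘ h) = g' ∘ (f' ∘ h).
Proof. by move=> e w h; rewrite -!compA e. Qed.

Lemma comp_eq1 O (C : category O) (x y z : O) (g : hom C y z) (f : hom C x y)
    (k : hom C x z) : g ∘ f = k ->
  forall w (h : hom C w x), g ∘ (f ∘ h) = k ∘ h.
Proof. by move=> e w h; rewrite -!compA e. Qed.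

Lemma iso_epi O (C : category O) (x y z : O) (i : hom C x y)
    (f g : hom C y z) : is_iso i -> f ∘ i = g ∘ i -> f = g.
Proof.
by move=> [j [_ ij]] e; rewrite -(compm1 f) -(compm1 g) -ij -!compA e.
Qed.

Lemma iso_mono O (C : category O) (x y z : O) (i : hom C y z)
    (f g : hom C x y) : is_iso i -> i ∘ f = i ∘ g -> f = g.
Proof.
by move=> [j [ji _]] e; rewrite -(comp1m f) -(comp1m g) -ji !compA e.
Qed.

Lemma iso_comp O (C : category O) (x y z : O) (g : hom C y z) (f : hom C x y) :
  is_iso g -> is_iso f -> is_iso (g ∘ f).
Proof.
move=> [g' [gg1 gg2]] [f' [ff1 ff2]]; exists (f' ∘ g'); split.
- by rewrite compA -(compA g') gg1 comp1m.
- by rewrite compA -(compA f) ff2 comp1m.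
Qed.

Lemma tens_comp X X' X'' Y Y' Y'' (f' : X' ⟶ X'') (f : X ⟶ X')
    (g' : Y' ⟶ Y'') (g : Y ⟶ Y') :
  (f' ⊗m g') ∘ (f ⊗m g) = (f' ∘ f) ⊗m (g' ∘ g).
Proof. by rewrite tensmM. Qed.

Lemma tens_compA X X' X'' Y Y' Y'' U (f' : X' ⟶ X'') (f : X ⟶ X')
    (g' : Y' ⟶ Y'') (g : Y ⟶ Y') (h : U ⟶ X ⊗ Y) :
  (f' ⊗m g') ∘ ((f ⊗m g) ∘ h) = ((f' ∘ f) ⊗m (g' ∘ g)) ∘ h.
Proof. by rewrite -compA tens_comp. Qed.

Definition tensE := (tens_comp, tens_compA, comp1m, compm1).

Lemma tens_iso X X' Y Y' (f : X ⟶ X') (g : Y ⟶ Y') :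
  is_iso f -> is_iso g -> is_iso (f ⊗m g).
Proof.
move=> [f' [ff1 ff2]] [g' [gg1 gg2]]; exists (f' ⊗m g').
by rewrite !tens_comp ff1 ff2 gg1 gg2 !tensm1.
Qed.

Lemma assoc_iso X Y Z : is_iso (assoc X Y Z).
Proof. by exists (assocV X Y Z); rewrite assocK assocVK. Qed.

Lemma lun_iso X : is_iso (lun X).
Proof. by exists (lunV X); rewrite lunK lunVK. Qed.

Lemma run_iso X : is_iso (run X).
Proof. by exists (runV X); rewrite runK runVK. Qed.

Lemma id_iso X : is_iso (id_ X).
Proof. by exists (id_ X); rewrite comp1m. Qed.

Lemma tens_unit_injl X Y (f g : X ⟶ Y) :
  id_ unit ⊗m f = id_ unit ⊗m g -> f = g.
Proof. by move=> e; apply: (iso_epi (lun_iso X)); rewrite -!lunN e. Qed.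

Lemma tens_unit_injr X Y (f g : X ⟶ Y) :
  f ⊗m id_ unit = g ⊗m id_ unit -> f = g.
Proof. by move=> e; apply: (iso_epi (run_iso X)); rewrite -!runN e. Qed.

Lemma lun_tens X Y : lun (X ⊗ Y) ∘ assoc unit X Y = lun X ⊗m id_ Y.
Proof.
apply: tens_unit_injl.
apply: (iso_epi (i := assoc unit (unit ⊗ X) Y ∘ (assoc unit unit X ⊗m id_ Y))).
  apply: iso_comp; first exact: assoc_iso.
  by apply: tens_iso; [exact: assoc_iso | exact: id_iso].
have -> : id_ unit ⊗m (lun (X ⊗ Y) ∘ assoc unit X Y)
        = (id_ unit ⊗m lun (X ⊗ Y)) ∘ (id_ unit ⊗m assoc unit X Y).
  by rewrite !tensE.
rewrite compA -(compA _ (assoc _ _ _)) -pentagon -compA triangle -tensm1.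
by rewrite -assocN -compA -assocN compA tens_comp triangle comp1m.
Qed.

Lemma lun_sym X : lun X ∘ sym X unit = run X.
Proof.
apply: tens_unit_injr; set U := unit.
have sI : is_iso (sym X U) by exists (sym U X); rewrite !symK.
apply: (iso_mono sI).
have hx := hexagon X U U.
have := f_equal (fun k => lun (U ⊗ X) ∘ k) hx.
rewrite -!compA lun_tens -symN !compA triangle => ->.
by rewrite -compA lunN !compA (comp_eq1 (lun_tens _ _)) !tensE.
Qed.

Lemma run_sym X : run X ∘ sym unit X = lun X.
Proof. by rewrite -lun_sym compA symK compm1. Qed.

Lemma sym_tensl X Y Z :
  sym (X ⊗ Y) Z =
  assoc Z X Y ∘ ((sym X Z ⊗m id_ Y) ∘
    (assocV X Z Y ∘ ((id_ X ⊗m sym Y Z) ∘ assoc X Y Z))).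
Proof.
have sI : is_iso (sym Z (X ⊗ Y)) by exists (sym (X ⊗ Y) Z); rewrite !symK.
apply: (iso_mono sI); rewrite symK; apply: (iso_mono (assoc_iso X Y Z)).
rewrite compm1 -!compA hexagon !compA tens_compA symK comp1m tensm1 comp1m.
by rewrite (comp_eq1 (assocVK _ _ _)) comp1m tens_compA symK comp1m tensm1
  comp1m.
Qed.

Lemma sym_sym X Y Z :
  sym (Y ⊗ X) Z ∘ (sym X Y ⊗m id_ Z) =
  assoc Z Y X ∘ (sym X (Z ⊗ Y) ∘ ((id_ X ⊗m sym Y Z) ∘ assoc X Y Z)).
Proof.
rewrite symN sym_tensl.
set g := assocV X Z Y ∘ _.
have <- : assoc X Z Y ∘ g = (id_ X ⊗m sym Y Z) ∘ assoc X Y Z.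
  by rewrite -compA assocVK comp1m.
by rewrite -!compA hexagon.
Qed.

Lemma tensm_compl X Y Z W (g : Y ⟶ Z) (f : X ⟶ Y) :
  (g ∘ f) ⊗m id_ W = (g ⊗m id_ W) ∘ (f ⊗m id_ W).
Proof. by rewrite !tensE. Qed.

Lemma tensm_compr X Y Z W (g : Y ⟶ Z) (f : X ⟶ Y) :
  id_ W ⊗m (g ∘ f) = (id_ W ⊗m g) ∘ (id_ W ⊗m f).
Proof. by rewrite !tensE. Qed.

Lemma curryN Z Z' X Y (f : Z ⊗ X ⟶ Y) (g : Z' ⟶ Z) :
  curry f ∘ g = curry (f ∘ (g ⊗m id_ X)).
Proof.
rewrite -[LHS]curry_ev -{1}(comp1m (id_ X)) tensmM.
by rewrite -compA ev_curry.
Qed.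

Lemma ev_curry_t Z X X' Y (f : Z ⊗ X ⟶ Y) (g : X' ⟶ X) :
  ev X Y ∘ (curry f ⊗m g) = f ∘ (id_ Z ⊗m g).
Proof. by rewrite -[in RHS](ev_curry f) compA !tensE. Qed.

Lemma ev_inj Z X Y (f g : Z ⟶ ihom X Y) :
  ev X Y ∘ (f ⊗m id_ X) = ev X Y ∘ (g ⊗m id_ X) -> f = g.
Proof. by move=> e; rewrite -(curry_ev f) e curry_ev. Qed.

End Coherence.

(* V-categories with type of objects [O]. *)
Record vcat (V : smcc) (O : Type) := VCat {
  vhom : O -> O -> V;
  vid : forall x, unit ⟶ vhom x x;
  vcomp : forall x y z, vhom y z ⊗ vhom x y ⟶ vhom x z;
  vcompA : forall x y z w,
    vcomp x y w ∘ (vcomp y z w ⊗m id_ (vhom x y)) =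
    vcomp x z w ∘ (id_ (vhom z w) ⊗m vcomp x y z)
      ∘ assoc (vhom z w) (vhom y z) (vhom x y);
  vcomp1m : forall x y,
    vcomp x y y ∘ (vid y ⊗m id_ (vhom x y)) = lun (vhom x y);
  vcompm1 : forall x y,
    vcomp x x y ∘ (id_ (vhom x y) ⊗m vid x) = run (vhom x y)
}.

Arguments vcomp {V O v} x y z.

#[local] Obligation Tactic := idtac.

Record vfun (V : smcc) OA OC (A : vcat V OA) (C : vcat V OC) := VFun {
  vob :> OA -> OC;
  vmap : forall x y, vhom A x y ⟶ vhom C (vob x) (vob y);
  vmap1 : forall x, vmap x x ∘ vid A x = vid C (vob x);
  vmapM : forall x y z,
    vmap x z ∘ vcomp x y z = vcomp _ _ _ ∘ (vmap y z ⊗m vmap x y)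
}.

Definition vfully_faithful (V : smcc) OA OC (A : vcat V OA) (C : vcat V OC)
    (P : vfun A C) : Prop :=
  forall x y, is_iso (vmap P x y).

Section VCategories.
Variable V : smcc.

Program Definition vfun_id OA (A : vcat V OA) : vfun A A :=
  @VFun V OA OA A A (fun x => x) (fun x y => id_ (vhom A x y)) _ _.
Next Obligation. by move=> *; rewrite comp1m. Qed.
Next Obligation. by move=> *; rewrite tensm1 comp1m compm1. Qed.

Program Definition vfun_comp OA OB OC (A : vcat V OA) (B : vcat V OB)
    (C : vcat V OC) (G : vfun B C) (F : vfun A B) : vfun A C :=
  @VFun V OA OC A C (fun x => G (F x))
    (fun x y => vmap G (F x) (F y) ∘ vmap F x y) _ _.
Next Obligation. by move=> *; rewrite compA !vmap1. Qed.
Next Obligation.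
by move=> *; rewrite tensmM compA vmapM -!compA vmapM.
Qed.

Program Definition vop OA (A : vcat V OA) : vcat V OA :=
  @VCat V OA (fun x y => vhom A y x) (fun x => vid A x)
    (fun x y z => vcomp z y x ∘ sym (vhom A z y) (vhom A y x)) _ _ _.
Next Obligation.
move=> OA A x y z w.
set h1 := vhom A w z; set h2 := vhom A z y; set h3 := vhom A y x.
rewrite -(comp1m (id_ h3)) tensmM compA.
rewrite (comp_eq (symN (vcomp w z y) (id_ h3))) sym_sym.
rewrite -{2}(comp1m (id_ h1)) tensmM !compA.
rewrite (comp_eq (symN (id_ h1) (vcomp z y x))) -!compA.
by rewrite (vcompA A w z y x).
Qed.
Next Obligation.
by move=> *; rewrite compA symN -compA vcompm1 run_sym.
Qed.
Next Obligation.
by move=> *; rewrite compA symN -compA vcomp1m lun_sym.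
Qed.

Program Definition vfun_op OA OC (A : vcat V OA) (C : vcat V OC)
    (F : vfun A C) : vfun (vop A) (vop C) :=
  @VFun V OA OC (vop A) (vop C) (fun x => F x) (fun x y => vmap F y x) _ _.
Next Obligation. by move=> *; exact: vmap1. Qed.
Next Obligation.
by move=> OA OC A C F x y z; rewrite /= -compA vmapM !compA symN.
Qed.

Program Definition vself : vcat V V :=
  @VCat V V (fun X Y => ihom X Y) (fun X => curry (lun X))
    (fun X Y Z => curry (ev Y Z ∘ (id_ (ihom Y Z) ⊗m ev X Y)
                          ∘ assoc (ihom Y Z) (ihom X Y) X)) _ _ _.
Next Obligation.
move=> X Y Z W /=; apply: ev_inj.
rewrite !tensm_compl !compA !(comp_eq1 (ev_curry _)) !compA.
rewrite assocN (comp_eq (assocN _ _ _)) !tens_compA tensm1 !comp1m compm1.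
rewrite ev_curry (comp_eq (ev_curry_t _ _)).
have := pentagon (ihom Z W) (ihom Y Z) (ihom X Y) X; rewrite compA => e.
rewrite !compA !tensm_compr !compA -e.
by rewrite -tensm1 (comp_eq (assocN _ _ _)).
Qed.
Next Obligation.
move=> X Y /=; apply: ev_inj; rewrite tensm_compl (comp_eq1 (ev_curry _)).
rewrite !compA assocN tens_compA tensm1 comp1m compm1.
by rewrite (comp_eq (ev_curry_t _ _)) (comp_eq (lunN _)) lun_tens.
Qed.
Next Obligation.
move=> X Y /=; apply: ev_inj; rewrite tensm_compl (comp_eq1 (ev_curry _)).
by rewrite !compA assocN tens_compA comp1m ev_curry triangle.
Qed.

(* The covariant representable [vhom A a -]. *)
Program Definition vrepr OA (A : vcat V OA) (a : OA) : vfun A vself :=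
  @VFun V OA V A vself (fun x => vhom A a x)
    (fun x y => curry (vcomp a x y)) _ _.
Next Obligation. by move=> OA A a x; rewrite /= curryN vcomp1m. Qed.
Next Obligation.
move=> OA A a x y z /=; apply: ev_inj.
rewrite !tensm_compl !(comp_eq1 (ev_curry _)) !compA assocN.
by rewrite tens_compA comp1m ev_curry (comp_eq (ev_curry_t _ _)) vcompA compA.
Qed.

(* The contravariant representable [vhom A - a]. *)
Definition vcorepr OA (A : vcat V OA) (a : OA) : vfun (vop A) vself :=
  vrepr (vop A) a.

Lemma vcompA_tens O (C : vcat V O) (x y z w : O) (X Y Z : V)
    (f : X ⟶ vhom C z w) (g : Y ⟶ vhom C y z) (h : Z ⟶ vhom C x y) :
  vcomp x y w ∘ ((vcomp y z w ∘ (f ⊗m g)) ⊗m h) =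
  vcomp x z w ∘ (f ⊗m (vcomp x y z ∘ (g ⊗m h))) ∘ assoc X Y Z.
Proof.
rewrite -(comp1m h) tensmM (comp_eq (vcompA _ _ _ _ _)) assocN.
by rewrite !compA tens_compA !comp1m.
Qed.

Lemma vcomp1m_tens O (C : vcat V O) (x y : O) (X : V) (f : X ⟶ vhom C x y) :
  vcomp x y y ∘ (vid C y ⊗m f) = f ∘ lun X.
Proof.
rewrite -(comp1m f) -{1}(compm1 (vid C y)) tensmM (comp_eq1 (vcomp1m _ _ _)).
by rewrite comp1m lunN.
Qed.

Lemma vcompm1_tens O (C : vcat V O) (x y : O) (X : V) (f : X ⟶ vhom C x y) :
  vcomp x x y ∘ (f ⊗m vid C x) = f ∘ run X.
Proof.
rewrite -(comp1m f) -{1}(compm1 (vid C x)) tensmM (comp_eq1 (vcompm1 _ _ _)).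
by rewrite comp1m runN.
Qed.

End VCategories.

Section Ends.
Variables (V : smcc) (OA OC : Type) (A : vcat V OA) (C : vcat V OC).
Implicit Types F G H : vfun A C.

(* Families [X ⟶ vhom C (F a) (G a)] that are (extraordinarily) V-natural
   in [a]; the end [is_end] of [vhom C (F a) (G a)] is the universal one. *)
Definition is_wedge F G (X : V) (p : forall a, X ⟶ vhom C (F a) (G a)) : Prop :=
  forall a a',
    vcomp (F a) (F a') (G a') ∘ (p a' ⊗m vmap F a a') =
    vcomp (F a) (G a) (G a') ∘ (vmap G a a' ⊗m p a) ∘ sym X (vhom A a a').

Definition is_end F G (E : V) (p : forall a, E ⟶ vhom C (F a) (G a)) : Prop :=
  is_wedge p /\
  forall X (q : forall a, X ⟶ vhom C (F a) (G a)), is_wedge q ->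
    exists! h : X ⟶ E, forall a, p a ∘ h = q a.

Record hom_end F G := HomEnd {
  end_ob : V;
  end_pr : forall a, end_ob ⟶ vhom C (F a) (G a);
  end_prop : is_end end_pr
}.

Definition end_lift F G (E : hom_end F G) X
    (q : forall a, X ⟶ vhom C (F a) (G a)) (hq : is_wedge q) : X ⟶ end_ob E :=
  proj1_sig (constructive_indefinite_description _
    (proj2 (end_prop E) X q hq)).

Lemma end_liftE F G (E : hom_end F G) X
    (q : forall a, X ⟶ vhom C (F a) (G a)) (hq : is_wedge q) a :
  end_pr E a ∘ end_lift E hq = q a.
Proof. by rewrite /end_lift; case: constructive_indefinite_description => h []. Qed.

Lemma wedge_comp F G X Y (p : forall a, X ⟶ vhom C (F a) (G a)) (h : Y ⟶ X) :
  is_wedge p -> is_wedge (fun a => p a ∘ h).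
Proof.
move=> hp a a'; rewrite -(compm1 (vmap F a a')) tensmM -compA hp.
by rewrite -(compm1 (vmap G a a')) tensmM !compA symN compm1.
Qed.

Lemma end_ext F G (E : hom_end F G) X (f g : X ⟶ end_ob E) :
  (forall a, end_pr E a ∘ f = end_pr E a ∘ g) -> f = g.
Proof.
move=> e; have [hE hu] := end_prop E.
have [h [_ uh]] := hu X _ (wedge_comp g hE).
by rewrite -(uh f e) -(uh g).
Qed.

End Ends.

Section EndsExist.
Variables (V : smcc) (OA : Set) (OC : Type) (A : vcat V OA) (C : vcat V OC).
Variables F G : vfun A C.

(* The diagram whose limit is the end of [vhom C (F a) (G a)]. *)
Inductive end_hom : OA + OA * OA -> OA + OA * OA -> Set :=
| end_id x : end_hom x x
| end_src a a' : end_hom (inl a) (inr (a, a'))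
| end_tgt a a' : end_hom (inl a') (inr (a, a')).

Definition end_into_inl x a (f : end_hom x (inl a)) :
    forall y, end_hom (inl a) y -> end_hom x y :=
  match f in end_hom x y' return
    match y' with
    | inl a => forall y, end_hom (inl a) y -> end_hom x y
    | inr _ => True
    end
  with
  | end_id (inl a) => fun y g => g
  | _ => I
  end.

Definition end_comp x y z (g : end_hom y z) : end_hom x y -> end_hom x z :=
  match g in end_hom y z return end_hom x y -> end_hom x z with
  | end_id _ => fun f => f
  | end_src a a' => fun f => end_into_inl f (end_src a a')
  | end_tgt a a' => fun f => end_into_inl f (end_tgt a a')
  end.

Program Definition end_shape : category (OA + OA * OA) :=
  @Category (OA + OA * OA) end_hom end_id end_comp _ _ _.
Next Obligation. by []. Qed.
Next Obligation. by move=> x y []. Qed.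
Next Obligation.
move=> x y z w h; case: w / h => //= a a' g f.
  by dependent destruction g.
by dependent destruction g.
Qed.

Definition end_diag_ob (x : OA + OA * OA) : V :=
  match x with
  | inl a => vhom C (F a) (G a)
  | inr (a, a') => ihom (vhom A a a') (vhom C (F a) (G a'))
  end.

Definition end_diag_map x y (f : end_hom x y) : end_diag_ob x ⟶ end_diag_ob y :=
  match f in end_hom x y return end_diag_ob x ⟶ end_diag_ob y with
  | end_id x => id_ (end_diag_ob x)
  | end_src a a' =>
      curry (vcomp (F a) (G a) (G a') ∘ (vmap G a a' ⊗m id_ _) ∘ sym _ _)
  | end_tgt a a' =>
      curry (vcomp (F a) (F a') (G a') ∘ (id_ _ ⊗m vmap F a a'))
  end.

Program Definition end_diag : functor end_shape (base V) :=
  @Functor _ _ end_shape (base V) end_diag_ob end_diag_map _ _.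
Next Obligation. by []. Qed.
Next Obligation.
move=> x y z g; case: z / g => /= [z | a a' | a a'] f; first by rewrite comp1m.
  by dependent destruction f; rewrite /= compm1.
by dependent destruction f; rewrite /= compm1.
Qed.

Lemma end_diag_wedge X (p : forall a, X ⟶ vhom C (F a) (G a)) :
  is_wedge p <->
  forall a a', end_diag_map (end_src a a') ∘ p a
             = end_diag_map (end_tgt a a') ∘ p a'.
Proof.
have e1 a a' : end_diag_map (end_src a a') ∘ p a =
    curry (vcomp (F a) (G a) (G a') ∘ (vmap G a a' ⊗m p a)
           ∘ sym X (vhom A a a')).
  by rewrite /= curryN !compA symN tens_compA comp1m compm1.
have e2 a a' : end_diag_map (end_tgt a a') ∘ p a' =
    curry (vcomp (F a) (F a') (G a') ∘ (p a' ⊗m vmap F a a')).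
  by rewrite /= curryN !compA tens_comp comp1m compm1.
split=> h a a'; first by rewrite e1 e2 h.
by have := h a a'; rewrite e1 e2 => e; rewrite -[LHS]ev_curry -e ev_curry.
Qed.

Lemma hom_end_exists : complete (base V) -> inhabited (hom_end F G).
Proof.
move=> hV; have [L [p [pc pu]]] := hV _ _ end_diag.
constructor; apply: (@HomEnd _ _ _ _ _ _ _ L (fun a => p (inl a))); split.
  apply/end_diag_wedge => a a'.
  by rewrite (pc _ _ (end_src a a')) (pc _ _ (end_tgt a a')).
move=> X q /end_diag_wedge hq.
pose q' (x : OA + OA * OA) : X ⟶ end_diag x :=
  match x return X ⟶ end_diag x with
  | inl a => q a
  | inr (a, a') => end_diag_map (end_src a a') ∘ q a
  end.
have [|h [hh hu]] := pu X q'.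
  move=> x y; case=> [[a|[a a']]|a a'|a a'] /=; rewrite ?comp1m //.
  by have /= <- := hq a a'.
exists h; split=> [a|k hk]; first exact: (hh (inl a)).
apply: hu => -[a|[a a']] /=; first exact: hk.
by rewrite -(pc _ _ (end_src a a')) -(hk a); exact: compA.
Qed.

Definition the_end (hV : complete (base V)) : hom_end F G :=
  epsilon (hom_end_exists hV) (fun _ => True).

End EndsExist.

(* The functor V-category, with hom-objects the ends of
   [vhom C (F a) (G a)]. *)
Section FunctorCategory.
Variables (V : smcc) (hV : complete (base V)).
Variables (OA : Set) (OC : Type) (A : vcat V OA) (C : vcat V OC).
Implicit Types F G H : vfun A C.

Lemma wedge_vid F : is_wedge (F := F) (G := F) (fun a => vid C (F a)).
Proof.
by move=> a a'; rewrite vcomp1m_tens vcompm1_tens compA run_sym.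
Qed.

Lemma wedge_vcomp F G H X Y (p : forall a, X ⟶ vhom C (G a) (H a))
    (q : forall a, Y ⟶ vhom C (F a) (G a)) :
  is_wedge p -> is_wedge q ->
  is_wedge (fun a => vcomp (F a) (G a) (H a) ∘ (p a ⊗m q a)).
Proof.
move=> hp hq a a'.
move: (hp a a') (hq a a').
set f := vmap F a a'; set g := vmap G a a'; set h := vmap H a a' => {}hp {}hq.
have MR (x y z w : OC) (Z1 Z2 Z3 : V) (t : Z1 ⟶ vhom C z w) (u : Z2 ⟶ vhom C y z)
    (v : Z3 ⟶ vhom C x y) :
    vcomp x z w ∘ (t ⊗m (vcomp x y z ∘ (u ⊗m v))) =
    vcomp x y w ∘ ((vcomp y z w ∘ (t ⊗m u)) ⊗m v) ∘ assocV _ _ _.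
  by rewrite vcompA_tens compA assocVK compm1.
rewrite vcompA_tens hq.
have -> : p a' ⊗m (vcomp (F a) (G a) (G a') ∘ (g ⊗m q a) ∘ sym _ _)
        = (p a' ⊗m (vcomp (F a) (G a) (G a') ∘ (g ⊗m q a)))
          ∘ (id_ X ⊗m sym Y (vhom A a a')).
  by rewrite tens_comp compm1.
rewrite -[in LHS](compA (vcomp _ _ _) (p _ ⊗m _)) [in LHS]MR hp.
have -> : (vcomp (G a) (H a) (H a') ∘ (h ⊗m p a) ∘ sym _ _) ⊗m q a
        = ((vcomp (G a) (H a) (H a') ∘ (h ⊗m p a)) ⊗m q a)
          ∘ (sym X (vhom A a a') ⊗m id_ Y).
  by rewrite tens_comp compm1.
rewrite -[in LHS](compA (vcomp _ _ _) (_ ⊗m q a)) vcompA_tens.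
by rewrite sym_tensl !compA.
Qed.

Program Definition vfunctors : vcat V (vfun A C) :=
  @VCat V (vfun A C) (fun F G => end_ob (the_end F G hV))
    (fun F => end_lift (the_end F F hV) (wedge_vid F))
    (fun F G H => end_lift (the_end F H hV)
       (wedge_vcomp (proj1 (end_prop (the_end G H hV)))
                    (proj1 (end_prop (the_end F G hV))))) _ _ _.
Next Obligation.
move=> F G H K; apply: end_ext => a.
rewrite -!compA !end_liftE !(compA (vcomp _ _ _)) !tens_comp !end_liftE.
by rewrite !compm1 vcompA_tens compA.
Qed.
Next Obligation.
move=> F G; apply: end_ext => a; rewrite -compA end_liftE compA tens_comp.
by rewrite end_liftE compm1 vcomp1m_tens.
Qed.
Next Obligation.
move=> F G; apply: end_ext => a; rewrite -compA end_liftE compA tens_comp.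
by rewrite end_liftE compm1 vcompm1_tens.
Qed.

End FunctorCategory.

Section Precomposition.
Variables (V : smcc) (hV : complete (base V)) (OA OB : Set).
Variables (A : vcat V OA) (B : vcat V OB) (J : vfun A B).
Variables (OC : Type) (C : vcat V OC).

Lemma wedge_precomp (F G : vfun B C) X
    (p : forall b, X ⟶ vhom C (F b) (G b)) : is_wedge p ->
  is_wedge (F := vfun_comp F J) (G := vfun_comp G J) (fun a => p (J a)).
Proof.
move=> hp a a'; rewrite /=.
have -> : p (J a') ⊗m (vmap F (J a) (J a') ∘ vmap J a a')
        = (p (J a') ⊗m vmap F (J a) (J a')) ∘ (id_ X ⊗m vmap J a a').
  by rewrite tens_comp compm1.
have -> : (vmap G (J a) (J a') ∘ vmap J a a') ⊗m p (J a)
        = (vmap G (J a) (J a') ⊗m p (J a)) ∘ (vmap J a a' ⊗m id_ X).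
  by rewrite tens_comp compm1.
by rewrite -compA hp !compA symN.
Qed.

Program Definition vprecomp : vfun (vfunctors hV B C) (vfunctors hV A C) :=
  @VFun V _ _ (vfunctors hV B C) (vfunctors hV A C)
    (fun F => vfun_comp F J)
    (fun F G => end_lift (the_end (vfun_comp F J) (vfun_comp G J) hV)
       (wedge_precomp (proj1 (end_prop (the_end F G hV))))) _ _.
Next Obligation.
by move=> F; apply: end_ext => a; rewrite -compA !end_liftE.
Qed.
Next Obligation.
move=> F G H; apply: end_ext => a; rewrite -!compA !end_liftE.
by rewrite compA tens_comp !end_liftE.
Qed.

End Precomposition.

Definition vlax_epi (V : smcc) (hV : complete (base V)) (OA OB : Set)
    (A : vcat V OA) (B : vcat V OB) (J : vfun A B) : Prop :=
  forall (OC : Set) (C : vcat V OC), vfully_faithful (vprecomp hV J C).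

Record vnat (V : smcc) OA OC (A : vcat V OA) (C : vcat V OC)
    (F G : vfun A C) := VNat {
  vnt :> forall a, unit ⟶ vhom C (F a) (G a);
  vnt_nat : forall a a',
    vcomp (F a) (F a') (G a') ∘ (vnt a' ⊗m vmap F a a')
      ∘ lunV (vhom A a a') =
    vcomp (F a) (G a) (G a') ∘ (vmap G a a' ⊗m vnt a)
      ∘ runV (vhom A a a')
}.

(* Composition in the underlying ordinary category of [C]. *)
Definition ucomp (V : smcc) OC (C : vcat V OC) (x y z : OC)
    (g : unit ⟶ vhom C y z) (f : unit ⟶ vhom C x y) : unit ⟶ vhom C x z :=
  vcomp x y z ∘ (g ⊗m f) ∘ lunV unit.

Definition visomorphic (V : smcc) OA OC (A : vcat V OA) (C : vcat V OC)
    (F G : vfun A C) : Prop :=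
  exists t : vnat F G, forall a, exists g : unit ⟶ vhom C (G a) (F a),
    ucomp g (t a) = vid C (F a) /\ ucomp (t a) g = vid C (G a).

Section WeightedColimits.
Variables (V : smcc) (OA OC : Type) (A : vcat V OA) (C : vcat V OC).
Variables (W : vfun (vop A) (vself V)) (F : vfun A C).
Variables (c : OC) (mu : forall a, W a ⟶ vhom C (F a) c).

Definition wcolim_map (d : OC) (a : OA) :
    vhom C c d ⟶ ihom (W a) (vhom C (F a) d) :=
  curry (vcomp (F a) c d ∘ (id_ (vhom C c d) ⊗m mu a)).

(* [c] is the colimit of [F] weighted by [W] with unit [mu]: the maps above
   exhibit [vhom C c d] as the object of V-natural transformations from [W]
   to [vhom C (F -) d].  The case of the identity of [c] shows that [mu] is
   then V-natural. *)
Definition is_wcolim : Prop :=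
  forall d : OC,
    is_end (F := W) (G := vfun_comp (vcorepr C d) (vfun_op F)) (wcolim_map d).

End WeightedColimits.

Section Kan.
Variables (V : smcc) (OA OB OC : Type).
Variables (A : vcat V OA) (B : vcat V OB) (C : vcat V OC).
Variables (J : vfun A B) (F : vfun A C) (L : vfun B C).
Variable eta : vnat F (vfun_comp L J).

Definition lan_unit (b : OB) (a : OA) : vhom B (J a) b ⟶ vhom C (F a) (L b) :=
  vcomp (F a) (L (J a)) (L b) ∘ (vmap L (J a) b ⊗m eta a)
    ∘ runV (vhom B (J a) b).

(* Pointwise: [L b] is the colimit of [F] weighted by [vhom B (J -) b]. *)
Definition is_lan : Prop :=
  forall b : OB,
    is_wcolim (W := vfun_comp (vcorepr B b) (vfun_op J)) (lan_unit b).

End Kan.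

Section Whiskering.
Variables (V : smcc) (OA OB OC OD : Type).
Variables (A : vcat V OA) (B : vcat V OB) (C : vcat V OC) (D : vcat V OD).
Variables (J : vfun A B) (F : vfun A C) (L : vfun B C).
Variables (K : vfun C D) (eta : vnat F (vfun_comp L J)).

Program Definition vwhisker :
    vnat (vfun_comp K F) (vfun_comp (vfun_comp K L) J) :=
  @VNat V OA OD A D (vfun_comp K F) (vfun_comp (vfun_comp K L) J)
    (fun a => vmap K (F a) (L (J a)) ∘ eta a) _.
Next Obligation.
move=> a a'; have := vnt_nat eta a a'; rewrite /= (compA (vmap K _ _)).
rewrite !tensmM -!(compA (vcomp _ _ _)) -!vmapM !(compA (vmap K _ _)).
by move=> /= ->.
Qed.

End Whiskering.

Section Density.
Variables (V : smcc) (OA OB : Type) (A : vcat V OA) (B : vcat V OB).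
Variable J : vfun A B.

Definition vdense : Prop :=
  exists (L : vfun B B) (eta : vnat J (vfun_comp L J)),
    is_lan eta /\ visomorphic L (vfun_id B).

Definition abs_vdense : Prop :=
  vdense /\
  forall (L : vfun B B) (eta : vnat J (vfun_comp L J)), is_lan eta ->
    forall K : vfun B (vself V), is_lan (vwhisker K eta).

End Density.

Definition abs_vcodense (V : smcc) (OA OB : Type) (A : vcat V OA)
    (B : vcat V OB) (J : vfun A B) : Prop :=
  abs_vdense (vfun_op J).

(* Main.v *)
From Stdlib Require Import ssreflect ssrfun ClassicalEpsilon.
Require Import Defs.

(* Being a lax epimorphism means that every V-natural family
   [X ⟶ vhom C (F (J a)) (G (J a))] extends uniquely to one indexed by the
   objects of [B]; this condition is self-dual, and it passes from small [C] to
   arbitrary [C], since only the objects [F b] and [G b] are involved.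

   Applied to the opposite of [J] and to [C := V], it turns the Yoneda
   isomorphism [vhom C (K b) d = ∫_b' [vhom B b' b, vhom C (K b') d]] into an
   end over [A], so every [K : B -> C] preserves [id = Lan_J J].

   Conversely, let [id = Lan_J J] with unit [e : J -> J].  Its preservation by
   the representables [vhom B b0 -] presents [vhom B b0 b] as the coend of
   [vhom B (J a) b ⊗ vhom B b0 (J a)] through [(g, u) |-> g e u].  A V-natural
   family [q] then induces a unique [P] with
   [P (x, g e u) = G (g e) (q_a x) (F u)], and its extension is
   [x |-> P (x, 1)]; it restricts to [q] because [e] has a left inverse. *)

Set Implicit Arguments.
Unset Strict Implicit.
Unset Printing Implicit Defensive.

(** * Unit coherence and multiplication in a V-category *)

Section UnitCoherence.
Variable V : smcc.
Implicit Types X Y Z W : V.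

(** Tensoring with [unit] is faithful and associators are invertible, so the pentagon and the
    triangle suffice. *)
Lemma run_tens X Y : (id_ X ⊗m run Y) ∘ assoc X Y unit = run (X ⊗ Y).
Proof.
apply: tens_unit_injr; rewrite -triangle tensm_compl.
apply: (iso_mono (assoc_iso X Y unit)).
rewrite -tensm1 -compA assocN !compA (comp_eq (assocN _ _ _)) pentagon -triangle.
by rewrite tensm_compr !compA.
Qed.

Lemma assoc_runV X Y : assoc X Y unit ∘ runV (X ⊗ Y) = id_ X ⊗m runV Y.
Proof.
apply: (iso_mono (i := id_ X ⊗m run Y)).
  by apply: tens_iso; [exact: id_iso | exact: run_iso].
by rewrite (comp_eq1 (run_tens X Y)) runVK tens_comp runVK comp1m tensm1.
Qed.

Lemma assoc_runV_tens X Y : assoc X unit Y ∘ (runV X ⊗m id_ Y) = id_ X ⊗m lunV Y.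
Proof.
apply: (iso_mono (i := id_ X ⊗m lun Y)).
  by apply: tens_iso; [exact: id_iso | exact: lun_iso].
by rewrite (comp_eq1 (triangle X Y)) !tens_comp runVK lunVK !comp1m.
Qed.

Lemma runVN X Y (f : X ⟶ Y) : (f ⊗m id_ unit) ∘ runV X = runV Y ∘ f.
Proof.
apply: (iso_mono (run_iso Y)).
by rewrite (comp_eq (runN f)) runVK compm1 -compA runVK comp1m.
Qed.

Lemma sym_lunV X : sym unit X ∘ lunV X = runV X.
Proof.
by apply: (iso_mono (run_iso X)); rewrite (comp_eq1 (run_sym X)) runVK lunVK.
Qed.

Lemma lun_unit : lun unit = run unit :> (unit ⊗ unit ⟶ (unit : V)).
Proof.
apply: tens_unit_injr; rewrite -triangle -lun_tens.
by congr (_ ∘ _); apply: (iso_mono (lun_iso _)); rewrite lunN.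
Qed.

Lemma lunV_unit : lunV unit = runV (unit : V).
Proof.
by apply: (iso_mono (lun_iso unit)); rewrite lunVK lun_unit runVK.
Qed.

Lemma curry_inj X Y Z (f g : X ⊗ Y ⟶ Z) : curry f = curry g -> f = g.
Proof. by move=> h; rewrite -(ev_curry f) h ev_curry. Qed.

End UnitCoherence.

(* [vmul], and below [coend_map] and [ext_left], are locked so that rewriting
   with [compA] does not look inside them. *)
Fact vmul_key : Datatypes.unit. Proof. exact: tt. Qed.

Section Multiplication.
Variables (V : smcc) (OC : Type) (C : vcat V OC).
Implicit Types (X Y Z W : V) (x y z w : OC).

Definition vmul x y z X Y (f : X ⟶ vhom C y z) (g : Y ⟶ vhom C x y) :
  X ⊗ Y ⟶ vhom C x z := locked_with vmul_key (vcomp x y z ∘ (f ⊗m g)).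

Lemma vmulE x y z X Y (f : X ⟶ vhom C y z) (g : Y ⟶ vhom C x y) :
  vmul f g = vcomp x y z ∘ (f ⊗m g).
Proof. by rewrite /vmul unlock. Qed.

Lemma vmul_tens x y z X Y X' Y' (f : X ⟶ vhom C y z) (g : Y ⟶ vhom C x y)
    (u : X' ⟶ X) (v : Y' ⟶ Y) :
  vmul f g ∘ (u ⊗m v) = vmul (f ∘ u) (g ∘ v).
Proof. by rewrite !vmulE compA tens_comp. Qed.

Lemma vmulA x y z w X Y Z (f : X ⟶ vhom C z w) (g : Y ⟶ vhom C y z)
    (h : Z ⟶ vhom C x y) :
  vmul (vmul f g) h = vmul f (vmul g h) ∘ assoc X Y Z.
Proof. by rewrite !vmulE; exact: vcompA_tens. Qed.

Lemma vmul_id x y z :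
  vmul (id_ (vhom C y z)) (id_ (vhom C x y)) = vcomp x y z.
Proof. by rewrite vmulE tensm1 compm1. Qed.

Lemma vmul1l x y X (f : X ⟶ vhom C x y) : vmul (vid C y) f = f ∘ lun X.
Proof. by rewrite vmulE vcomp1m_tens. Qed.

Lemma vmul1r x y X (f : X ⟶ vhom C x y) : vmul f (vid C x) = f ∘ run X.
Proof. by rewrite vmulE vcompm1_tens. Qed.

End Multiplication.

Lemma vmap_vmul (V : smcc) OA OC (A : vcat V OA) (C : vcat V OC) (F : vfun A C)
    x y z X Y (f : X ⟶ vhom A y z) (g : Y ⟶ vhom A x y) :
  vmap F x z ∘ vmul f g = vmul (vmap F y z ∘ f) (vmap F x y ∘ g).
Proof. by rewrite !vmulE -compA vmapM compA tens_comp. Qed.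

(** * Wedges and contravariant representables *)

Section Wedges.
Variables (V : smcc) (OA OC : Type) (A : vcat V OA) (C : vcat V OC).

Lemma is_wedgeE (F G : vfun A C) (X : V) (p : forall a, X ⟶ vhom C (F a) (G a)) :
  is_wedge p <->
  forall a a', vmul (p a') (vmap F a a') =
    vmul (vmap G a a') (p a) ∘ sym X (vhom A a a').
Proof. by split=> h a a'; move: (h a a'); rewrite !vmulE. Qed.

(** V-natural transformations are wedges with vertex [unit], because the symmetry exchanges the two
    unitors. *)
Lemma vnat_wedge (F G : vfun A C) (t : vnat F G) : is_wedge t.
Proof.
move=> a a'; apply: (iso_epi (i := lunV (vhom A a a'))).
  by exists (lun _); rewrite lunVK lunK.
by rewrite vnt_nat [RHS]compA sym_lunV.
Qed.

Lemma wedge_vnat (F G : vfun A C) (t : forall a, unit ⟶ vhom C (F a) (G a)) :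
  is_wedge t -> forall a a',
    vcomp (F a) (F a') (G a') ∘ (t a' ⊗m vmap F a a') ∘ lunV (vhom A a a') =
    vcomp (F a) (G a) (G a') ∘ (vmap G a a' ⊗m t a) ∘ runV (vhom A a a').
Proof. by move=> ht a a'; rewrite ht compA sym_lunV. Qed.

End Wedges.

Section UnderlyingWedges.
Variables (V : smcc) (OA : Set) (OC : Type) (A : vcat V OA) (C : vcat V OC).

Lemma wedge_ucomp (F G H : vfun A C) (s : forall a, unit ⟶ vhom C (G a) (H a))
    (t : forall a, unit ⟶ vhom C (F a) (G a)) :
  is_wedge s -> is_wedge t -> is_wedge (fun a => ucomp (s a) (t a)).
Proof. by move=> hs ht; exact: (wedge_comp (lunV unit) (wedge_vcomp hs ht)). Qed.

End UnderlyingWedges.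

Section Corepresentables.
Variable V : smcc.

Lemma ev_vcorepr OA OC (A : vcat V OA) (C : vcat V OC) (F : vfun A C) (d : OC)
    (a a' : OA) (Y : V) (g : Y ⟶ vhom C (F a) d) :
  ev (vhom C (F a) d) (vhom C (F a') d) ∘
    (vmap (vfun_comp (vcorepr C d) (vfun_op F)) a a' ⊗m g) =
  vmul g (vmap F a' a) ∘ sym (vhom A a' a) Y.
Proof.
by rewrite /= curryN ev_curry_t vmulE !compA tens_comp comp1m compm1 symN.
Qed.

Lemma ev_vself (X Y Z T U W : V) (f : T ⟶ ihom Y Z) (g : U ⟶ ihom X Y)
    (h : W ⟶ X) :
  ev X Z ∘ (vmul (C := vself V) f g ⊗m h) =
  ev Y Z ∘ (f ⊗m (ev X Y ∘ (g ⊗m h))) ∘ assoc T U W.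
Proof.
rewrite vmulE /= curryN ev_curry_t !compA tens_comp comp1m compm1 assocN.
by rewrite !tensE.
Qed.

Variables (OA OB OC : Type) (A : vcat V OA) (B : vcat V OB) (C : vcat V OC).
Variables (J : vfun A B) (F : vfun A C) (b : OB) (d : OC).

(* Precomposing the wedge condition with the exchange of the last two factors
   removes every symmetry from it. *)
Lemma wedge_corepr (X : V)
    (p : forall a, X ⟶ ihom (vhom B (J a) b) (vhom C (F a) d))
    (q := fun a => ev (vhom B (J a) b) (vhom C (F a) d) ∘ (p a ⊗m id_ _)) :
  is_wedge (F := vfun_comp (vcorepr B b) (vfun_op J))
           (G := vfun_comp (vcorepr C d) (vfun_op F)) p <->
  forall a a',
    q a' ∘ (id_ X ⊗m vmul (id_ (vhom B (J a) b)) (vmap J a' a)) ∘ assoc _ _ _ =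
    vmul (q a) (vmap F a' a).
Proof.
pose s a a' :
    (X ⊗ vhom B (J a) b) ⊗ vhom A a' a ⟶ (X ⊗ vhom A a' a) ⊗ vhom B (J a) b :=
  assocV _ _ _ ∘ ((id_ X ⊗m sym _ _) ∘ assoc _ _ _).
have sI a a' : is_iso (s a a').
  have h : is_iso (sym (vhom B (J a) b) (vhom A a' a)).
    by exists (sym _ _); rewrite !symK.
  apply: iso_comp; first by exists (assoc _ _ _); rewrite assocK assocVK.
  by apply: iso_comp; [apply: tens_iso => //; exact: id_iso | exact: assoc_iso].
have key a a' :
   ev _ _ ∘ (vmul (C := vself V) (p a')
     (vmap (vfun_comp (vcorepr B b) (vfun_op J)) a a') ⊗m id_ _) ∘ s a a' =
   q a' ∘ (id_ X ⊗m vmul (id_ (vhom B (J a) b)) (vmap J a' a)) ∘ assoc _ _ _ /\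
   ev _ _ ∘ ((vmul (C := vself V) (vmap (vfun_comp (vcorepr C d) (vfun_op F)) a a')
       (p a) ∘ sym X (vhom A a' a)) ⊗m id_ _) ∘ s a a' =
   vmul (q a) (vmap F a' a).
  split.
    rewrite ev_vself (ev_vcorepr (F := J) a') /s !compA.
    rewrite (comp_eq1 (assocVK _ _ _)) comp1m.
    rewrite /= tens_compA compm1 compA symK compm1 /q.
    by rewrite tens_compA comp1m compm1.
  rewrite -(comp1m (id_ (vhom B (J a) b))) tensmM -[X in X ∘ s a a']compA.
  rewrite ev_vself (ev_vcorepr (F := F) a') !compA.
  (* By the hexagon this is the symmetry moving [vhom A a' a] past both other factors; it cancels
     the one left by [ev_vcorepr]. *)
  have -> : assoc (vhom A a' a) X (vhom B (J a) b)
    ∘ (sym X (vhom A a' a) ⊗m id_ (vhom B (J a) b) ∘ s a a') = sym _ _.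
    by rewrite sym_tensl.
  by rewrite symK compm1.
split=> h.
  move/is_wedgeE: h => h a a'; have [<- <-] := key a a'.
  by rewrite -(h a a').
apply/is_wedgeE => a a'; apply: ev_inj; apply: (iso_epi (sI a a')).
have [e1 e2] := key a a'; etransitivity; first exact: e1.
by rewrite h; symmetry; exact: e2.
Qed.

End Corepresentables.

(** * Unique extension of V-natural families *)

(** Full faithfulness of precomposition with [J], tested on generalized elements of the ends, so
    that no end has to be chosen. *)
Definition extends_wedges (V : smcc) OA OB OC (A : vcat V OA) (B : vcat V OB)
    (J : vfun A B) (C : vcat V OC) : Prop :=
  forall (F G : vfun B C) (X : V) (q : forall a, X ⟶ vhom C (F (J a)) (G (J a))),
    is_wedge (F := vfun_comp F J) (G := vfun_comp G J) q ->
  exists p : forall b, X ⟶ vhom C (F b) (G b),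
    is_wedge p /\ (forall a, p (J a) = q a) /\
    forall p' : forall b, X ⟶ vhom C (F b) (G b),
      is_wedge p' -> (forall a, p' (J a) = q a) -> forall b, p' b = p b.

#[local] Obligation Tactic := idtac.

Section LaxEpi.
Variables (V : smcc) (hV : complete (base V)) (OA OB : Set).
Variables (A : vcat V OA) (B : vcat V OB) (J : vfun A B).

(** A map from [X] into an end is a wedge with vertex [X], so unique extension says that composing
    with the comparison of ends is bijective. *)
Lemma fully_faithful_extends OC (C : vcat V OC) :
  vfully_faithful (vprecomp hV J C) <-> extends_wedges J C.
Proof.
split=> [hJ F G X q hq | hJ F G].
- have [k [kl kr]] := hJ F G.
  pose E := the_end F G hV; have hE := proj1 (end_prop E).
  pose E' := the_end (vfun_comp F J) (vfun_comp G J) hV.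
  have prJ a : end_pr E' a ∘ vmap (vprecomp hV J C) F G = end_pr E (J a).
    by rewrite /= end_liftE.
  exists (fun b => end_pr E b ∘ (k ∘ end_lift E' hq)); split; last split.
  + exact: wedge_comp.
  + move=> a; rewrite -(prJ a) !compA (comp_eq1 kr) comp1m.
    exact: (end_liftE E' hq a).
  + move=> p hp hpq b; rewrite -(end_liftE E hp b); congr (_ ∘ _).
    apply: (iso_mono (hJ F G)); rewrite -[RHS]compA kr comp1m.
    apply: (@end_ext _ _ _ _ _ _ _ E') => a.
    by rewrite -compA prJ (end_liftE E hp) hpq (end_liftE E' hq).
- pose E := the_end F G hV; have hE := proj1 (end_prop E).
  pose E' := the_end (vfun_comp F J) (vfun_comp G J) hV.
  have prJ a : end_pr E' a ∘ vmap (vprecomp hV J C) F G = end_pr E (J a).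
    by rewrite /= end_liftE.
  (* The inverse is the lift of the extension of the universal wedge over [A]. *)
  have [p [hp [pJ _]]] := hJ F G _ _ (proj1 (end_prop E')).
  have [r [_ [_ ur]]] := hJ F G _ _ (wedge_precomp J hE).
  exists (end_lift E hp); split.
    apply: (@end_ext _ _ _ _ _ _ _ E) => b; rewrite -compA end_liftE compm1.
    rewrite (ur _ hE) // (ur (fun b => p b ∘ vmap (vprecomp hV J C) F G)) //.
      exact: wedge_comp.
    by move=> a; rewrite /= pJ; exact: prJ.
  apply: (@end_ext _ _ _ _ _ _ _ E') => a.
  by rewrite -compA prJ end_liftE pJ compm1.
Qed.

Lemma vlax_epiE :
  vlax_epi hV J <-> forall (OC : Set) (C : vcat V OC), extends_wedges J C.
Proof. by split=> h OC C; apply/fully_faithful_extends. Qed.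

End LaxEpi.

(** * Passage from small to large V-categories *)

Section FullImage.
Variables (V : smcc) (O OC : Type) (C : vcat V OC) (f : O -> OC).

Definition vfull : vcat V O :=
  @VCat V O (fun x y => vhom C (f x) (f y)) (fun x => vid C (f x))
    (fun x y z => vcomp (f x) (f y) (f z))
    (fun x y z w => vcompA C (f x) (f y) (f z) (f w))
    (fun x y => vcomp1m C (f x) (f y)) (fun x y => vcompm1 C (f x) (f y)).

End FullImage.

(** [F] and [G] factor through a V-category on the small type [OB + OB] whose hom-objects are those
    of [C], so wedges are unchanged. *)
Lemma extends_wedges_large (V : smcc) (OA OB : Set) (A : vcat V OA) (B : vcat V OB)
    (J : vfun A B) :
  (forall (OC : Set) (C : vcat V OC), extends_wedges J C) ->
  forall (OC : Type) (C : vcat V OC), extends_wedges J C.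
Proof.
move=> h OC C F G X q hq.
pose f x := match x with inl b => F b | inr b => G b end.
pose F' : vfun B (vfull C f) :=
  @VFun _ _ _ B (vfull C f) inl (vmap F) (vmap1 F) (vmapM F).
pose G' : vfun B (vfull C f) :=
  @VFun _ _ _ B (vfull C f) inr (vmap G) (vmap1 G) (vmapM G).
exact: (h _ (vfull C f) F' G' X q hq).
Qed.

(** * Duality *)

Section Opposite.
Variables (V : smcc) (OB OC : Type) (B : vcat V OB) (C : vcat V OC).

(** Not an instance of [vfun_op]: composition in [vop (vop B)] carries two symmetries, so it is not
    convertible to [B]. *)
Program Definition vfun_unop (F : vfun (vop B) C) : vfun B (vop C) :=
  @VFun V OB OC B (vop C) (fun x => F x) (fun x y => vmap F y x) _ _.
Next Obligation. move=> F x; exact: (vmap1 F x). Qed.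
Next Obligation.
move=> F x y z; have e := vmapM F z y x; rewrite /= in e.
apply: (iso_epi (i := sym (vhom B x y) (vhom B y z))).
  by exists (sym _ _); rewrite !symK.
by rewrite compA e /= !compA -symN (comp_eq1 (symK _ _)) comp1m.
Qed.

End Opposite.

Section OppositeWedges.
Variable V : smcc.

(** The symmetry is natural and involutive, so the second equation, the first read in [vop C], has
    the same sides exchanged. *)
Lemma vcomp_flip OC (C : vcat V OC) (x y y' z : OC) (X Y : V)
    (p' : X ⟶ vhom C y z) (f : Y ⟶ vhom C x y)
    (g : Y ⟶ vhom C y' z) (p : X ⟶ vhom C x y') :
  vcomp x y z ∘ (p' ⊗m f) = vcomp x y' z ∘ (g ⊗m p) ∘ sym X Y <->
  vcomp x y' z ∘ sym _ _ ∘ (p ⊗m g) = vcomp x y z ∘ sym _ _ ∘ (f ⊗m p') ∘ sym X Y.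
Proof.
by rewrite !compA !symN (comp_eq (symN _ _)) symK compm1; split=> ->.
Qed.

Variables (OB OC : Type) (B : vcat V OB) (C : vcat V OC) (X : V).

Lemma wedge_op (F G : vfun B C) (p : forall b, X ⟶ vhom C (F b) (G b)) :
  is_wedge p <-> is_wedge (F := vfun_op G) (G := vfun_op F) p.
Proof.
split=> h b b'.
  exact: (proj1 (vcomp_flip (p b) (vmap F b' b) (vmap G b' b) (p b')) (h b' b)).
exact: (proj2 (vcomp_flip (p b') (vmap F b b') (vmap G b b') (p b)) (h b' b)).
Qed.

Lemma wedge_unop (F G : vfun (vop B) C) (p : forall b, X ⟶ vhom C (F b) (G b)) :
  is_wedge p <-> is_wedge (F := vfun_unop G) (G := vfun_unop F) p.
Proof.
split=> h b b'.
  exact: (proj1 (vcomp_flip (p b) (vmap F b' b) (vmap G b' b) (p b')) (h b' b)).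
exact: (proj2 (vcomp_flip (p b') (vmap F b b') (vmap G b b') (p b)) (h b' b)).
Qed.

End OppositeWedges.

Lemma extends_wedges_unop (V : smcc) OA OB OC (A : vcat V OA) (B : vcat V OB)
    (J : vfun A B) (C : vcat V OC) :
  extends_wedges (vfun_op J) (vop C) -> extends_wedges J C.
Proof.
move=> h F G X q hq.
have [|p [hp [pJ pu]]] := h (vfun_op G) (vfun_op F) X q.
  exact: (proj1 (wedge_op (F := vfun_comp F J) (G := vfun_comp G J) q)).
exists p; split; first exact/wedge_op.
by split=> // p' /wedge_op hp'; exact: pu.
Qed.

Lemma extends_wedges_op (V : smcc) OA OB OC (A : vcat V OA) (B : vcat V OB)
    (J : vfun A B) (C : vcat V OC) :
  extends_wedges J (vop C) -> extends_wedges (vfun_op J) C.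
Proof.
move=> h F G X q hq.
have [|p [hp [pJ pu]]] := h (vfun_unop G) (vfun_unop F) X q.
  exact: (proj1 (wedge_unop (F := vfun_comp F (vfun_op J))
    (G := vfun_comp G (vfun_op J)) q)).
exists p; split; first exact/wedge_unop.
by split=> // p' /wedge_unop hp'; exact: pu.
Qed.

(** * Weighted colimits and the Yoneda lemma *)

Section Insertion.
Variable V : smcc.
Implicit Types X Y Z W : V.

(** In elements: [x |-> (x, y)]. *)
Definition insr X Y (y : unit ⟶ Y) : X ⟶ X ⊗ Y := (id_ X ⊗m y) ∘ runV X.

Lemma assoc_insr_tens X Y Z (y : unit ⟶ Y) :
  assoc X Y Z ∘ (insr X y ⊗m id_ Z) = id_ X ⊗m ((y ⊗m id_ Z) ∘ lunV Z).
Proof.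
rewrite /insr tensm_compl (comp_eq (assocN _ _ _)) assoc_runV_tens.
by rewrite tens_comp comp1m.
Qed.

Lemma assoc_insr X Y Z (z : unit ⟶ Z) :
  assoc X Y Z ∘ insr (X ⊗ Y) z = id_ X ⊗m insr Y z.
Proof.
rewrite /insr -tensm1 (comp_eq (assocN _ _ _)) assoc_runV.
by rewrite tens_comp comp1m.
Qed.

Lemma insrN X X' Y (f : X ⟶ X') (y : unit ⟶ Y) :
  (f ⊗m id_ Y) ∘ insr X y = insr X' y ∘ f.
Proof.
by rewrite /insr -compA tens_comp compm1 comp1m compA -runVN -compA tens_comp
  compm1 comp1m.
Qed.

Lemma vmul_insr OC (C : vcat V OC) (x y z : OC) X Y (f : X ⟶ vhom C y z)
    (g : Y ⟶ vhom C x y) (t : unit ⟶ Y) :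
  vmul f g ∘ insr X t = vmul f (g ∘ t) ∘ runV X.
Proof. by rewrite /insr -compA vmul_tens compm1. Qed.

End Insertion.

Section WeightedColimits.
Variable V : smcc.
Variables (OA OC : Type) (A : vcat V OA) (C : vcat V OC).
Variables (W : vfun (vop A) (vself V)) (F : vfun A C).

Lemma wcolim_mapE (c : OC) (mu : forall a, W a ⟶ vhom C (F a) c) (d : OC) a X
    (h : X ⟶ vhom C c d) :
  wcolim_map mu d a ∘ h = curry (vmul h (mu a)).
Proof. by rewrite /wcolim_map curryN -vmulE vmul_tens comp1m compm1. Qed.

Lemma wcolim_lift (c : OC) (mu : forall a, W a ⟶ vhom C (F a) c) (d : OC)
    (nu : forall a, W a ⟶ vhom C (F a) d) :
  is_wcolim mu -> is_wcolim nu ->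
  exists t : unit ⟶ vhom C c d, forall a, vmul t (mu a) = nu a ∘ lun (W a).
Proof.
move=> hmu hnu.
(* The identity of [d] makes [nu] a wedge with vertex [unit], to which the universal property of [c]
   applies. *)
have [h [hh _]] := proj2 (hmu d) unit _ (wedge_comp (vid C d) (proj1 (hnu d))).
exists h => a; have := hh a; rewrite !wcolim_mapE vmul1l => e.
by rewrite -[LHS]ev_curry e ev_curry.
Qed.

Lemma wcolim_ext (c : OC) (mu : forall a, W a ⟶ vhom C (F a) c) (d : OC) X
    (f g : X ⟶ vhom C c d) :
  is_wcolim mu -> (forall a, vmul f (mu a) = vmul g (mu a)) -> f = g.
Proof.
move=> hmu e; have [h [_ uh]] := proj2 (hmu d) X _ (wedge_comp g (proj1 (hmu d))).
by rewrite -(uh g) // -(uh f) // => a; rewrite !wcolim_mapE e.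
Qed.

End WeightedColimits.

Section Underlying.
Variables (V : smcc) (OC : Type) (C : vcat V OC).

Lemma lunV_iso (X : V) : is_iso (lunV X).
Proof. by exists (lun X); rewrite lunK lunVK. Qed.

Lemma ucomp_vmul (x y z w : OC) X (s : unit ⟶ vhom C z w) (t : unit ⟶ vhom C y z)
    (f : X ⟶ vhom C x y) :
  vmul (ucomp s t) f ∘ lunV X = vmul s (vmul t f ∘ lunV X) ∘ lunV X.
Proof.
rewrite /ucomp -vmulE -{1}(compm1 f) -vmul_tens vmulA !compA.
rewrite lunV_unit (comp_eq1 (assoc_runV_tens _ _)) -!compA vmul_tens.
by rewrite compm1.
Qed.

Lemma vmul_ucomp (x y z w : OC) X (s : unit ⟶ vhom C y z) (t : unit ⟶ vhom C x y)
    (f : X ⟶ vhom C z w) :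
  vmul f (ucomp s t) ∘ runV X = vmul (vmul f s ∘ runV X) t ∘ runV X.
Proof.
rewrite /ucomp -vmulE -[in RHS](compm1 t) -[in RHS]vmul_tens vmulA !compA.
by rewrite (comp_eq1 (assoc_runV_tens _ _)) -!compA vmul_tens compm1.
Qed.

Lemma precomp_iso (x y d : OC) (t : unit ⟶ vhom C x y) (s : unit ⟶ vhom C y x) :
  ucomp s t = vid C x -> ucomp t s = vid C y ->
  is_iso (vmul (id_ (vhom C y d)) t ∘ runV _).
Proof.
have pre (x' y' : OC) (u : unit ⟶ vhom C x' y') X (f : X ⟶ vhom C y' d) :
    vmul (id_ _) u ∘ runV _ ∘ f = vmul f u ∘ runV _.
  by rewrite compA -runVN -compA vmul_tens comp1m compm1.
move=> st ts; exists (vmul (id_ (vhom C x d)) s ∘ runV _).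
by rewrite !pre -!vmul_ucomp st ts !vmul1r !compA !runVK !comp1m.
Qed.

End Underlying.

Lemma is_end_iso (V : smcc) OA OC (A : vcat V OA) (C : vcat V OC)
    (F G : vfun A C) (E E' : V)
    (p : forall a, E ⟶ vhom C (F a) (G a)) (i : E' ⟶ E)
    (p' : forall a, E' ⟶ vhom C (F a) (G a)) :
  is_end p -> is_iso i -> (forall a, p' a = p a ∘ i) -> is_end p'.
Proof.
move=> [hp up] [j [ji ij]] e; split.
  by move=> a a'; rewrite !e; exact: wedge_comp.
move=> X q hq; have [h [hh uh]] := up X q hq.
exists (j ∘ h); split=> [a | k hk].
  by rewrite e compA (comp_eq1 ij) comp1m.
by rewrite (uh (i ∘ k)) ?(comp_eq1 ji) ?comp1m // => a; rewrite -compA -e hk.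
Qed.

Section WeightedColimitsIso.
Variable V : smcc.
Variables (OA OC : Type) (A : vcat V OA) (C : vcat V OC).
Variables (W : vfun (vop A) (vself V)) (F : vfun A C).
Variables (c d : OC) (mu : forall a, W a ⟶ vhom C (F a) c).
Variable (nu : forall a, W a ⟶ vhom C (F a) d).

(** [wcolim_map nu] is [wcolim_map mu] after precomposition with [t], an isomorphism of
    hom-objects. *)
Lemma wcolim_iso (t : unit ⟶ vhom C c d) (s : unit ⟶ vhom C d c) :
  ucomp s t = vid C c -> ucomp t s = vid C d ->
  (forall a, nu a = vmul t (mu a) ∘ lunV (W a)) ->
  is_wcolim mu -> is_wcolim nu.
Proof.
move=> st ts e hmu x; apply: (is_end_iso (hmu x) (precomp_iso x st ts)) => a.
rewrite wcolim_mapE -[LHS]compm1 wcolim_mapE e; congr curry.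
rewrite -[in RHS](compm1 (mu a)) -[in RHS]vmul_tens vmulA compA assoc_runV_tens.
by rewrite vmul_tens compm1.
Qed.

Lemma wcolim_unique :
  is_wcolim mu -> is_wcolim nu ->
  exists (t : unit ⟶ vhom C c d) (s : unit ⟶ vhom C d c),
    ucomp s t = vid C c /\ ucomp t s = vid C d /\
    forall a, nu a = vmul t (mu a) ∘ lunV (W a).
Proof.
move=> hmu hnu.
have [t ht] := wcolim_lift hmu hnu; have [s hs] := wcolim_lift hnu hmu.
exists t, s; split; [|split].
- apply: (wcolim_ext hmu) => a; apply: (iso_epi (lunV_iso _)).
  by rewrite ucomp_vmul ht vmul1l !compA lunVK compm1 hs compA lunVK.
- apply: (wcolim_ext hnu) => a; apply: (iso_epi (lunV_iso _)).
  by rewrite ucomp_vmul hs vmul1l !compA lunVK compm1 ht compA lunVK.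
- by move=> a; rewrite ht compA lunVK compm1.
Qed.

End WeightedColimitsIso.

Section Yoneda.
Variables (V : smcc) (OB OC : Type) (B : vcat V OB) (C : vcat V OC).
Variables (K : vfun B C) (b : OB) (d : OC).

Lemma wedge_corepr_self (X : V)
    (p : forall x, X ⟶ ihom (vhom B x b) (vhom C (K x) d))
    (q := fun x => ev (vhom B x b) (vhom C (K x) d) ∘ (p x ⊗m id_ _)) :
  is_wedge (F := vcorepr B b) (G := vfun_comp (vcorepr C d) (vfun_op K)) p <->
  forall x x',
    q x' ∘ (id_ X ⊗m vcomp x' x b) ∘ assoc _ _ _ = vmul (q x) (vmap K x' x).
Proof.
have e x x' : vcomp x' x b = vmul (id_ (vhom B x b)) (vmap (vfun_id B) x' x).
  by rewrite vmulE tensm1 compm1.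
split=> h.
  move=> x x'; rewrite e.
  apply: (proj1 (wedge_corepr (J := vfun_id B) (F := K) (b := b) p)) => y y' /=.
  by rewrite compm1; exact: h.
have h' := proj2 (wedge_corepr (J := vfun_id B) (F := K) (b := b) (d := d) p).
have /h' {}h' : forall x x', q x' ∘ (id_ X ⊗m vmul (id_ (vhom B x b))
    (vmap (vfun_id B) x' x)) ∘ assoc _ _ _ = vmul (q x) (vmap K x' x).
  by move=> x x'; rewrite -e h.
by move=> x x'; have := h' x x'; rewrite /= compm1.
Qed.

(** In elements: [g |-> (u |-> g (K u))]. *)
Definition yoneda_map x : vhom C (K b) d ⟶ ihom (vhom B x b) (vhom C (K x) d) :=
  curry (vmul (id_ _) (vmap K x b)).

Lemma yoneda_map_comp X (h : X ⟶ vhom C (K b) d) x :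
  yoneda_map x ∘ h = curry (vmul h (vmap K x b)).
Proof. by rewrite /yoneda_map curryN vmul_tens comp1m compm1. Qed.

Lemma yoneda_wedge :
  is_wedge (F := vcorepr B b) (G := vfun_comp (vcorepr C d) (vfun_op K)) yoneda_map.
Proof.
apply/wedge_corepr_self => x x'; rewrite !ev_curry vmulA vmul_tens.
by rewrite compm1 vmapM -vmulE.
Qed.

(** Evaluation at the identity of [b]. *)
Definition yoneda_elt X (p : forall x, X ⟶ ihom (vhom B x b) (vhom C (K x) d)) :
    X ⟶ vhom C (K b) d :=
  ev _ _ ∘ (p b ⊗m id_ _) ∘ insr X (vid B b).

(** The wedge condition at the identity of [b] reads [p_x (1 v) = p_b (1) (K v)]. *)
Lemma yoneda_eltK X (p : forall x, X ⟶ ihom (vhom B x b) (vhom C (K x) d)) x :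
  is_wedge (F := vcorepr B b) (G := vfun_comp (vcorepr C d) (vfun_op K)) p ->
  p x = yoneda_map x ∘ yoneda_elt p.
Proof.
move=> /wedge_corepr_self h; rewrite yoneda_map_comp /yoneda_elt.
rewrite -[X in vmul _ X]compm1 -vmul_tens -h -[LHS]curry_ev; congr curry.
rewrite !compA assoc_insr_tens tens_comp.
by rewrite (comp_eq1 (vcomp1m _ _ _)) lunVK comp1m tensm1 compm1.
Qed.

Lemma yoneda_mapK X (h : X ⟶ vhom C (K b) d) :
  yoneda_elt (fun x => yoneda_map x ∘ h) = h.
Proof.
rewrite /yoneda_elt yoneda_map_comp ev_curry vmul_insr vmap1 vmul1r.
by rewrite compA runVK compm1.
Qed.

End Yoneda.

(** * From extension to absolute density *)

Section Dense.
Variables (V : smcc) (OA OB : Set) (A : vcat V OA) (B : vcat V OB).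
Variable J : vfun A B.

Hypothesis hJ : extends_wedges (vfun_op J) (vself V).

(** By Yoneda [vhom C (K b) d] is an end over [B]; unique extension along the opposite of [J] makes
    it an end over [A]. Thus every [K] is the pointwise left Kan extension of its restriction along
    [J]. *)
Lemma extends_wcolim OC (C : vcat V OC) (K : vfun B C) b :
  is_wcolim (W := vfun_comp (vcorepr B b) (vfun_op J)) (F := vfun_comp K J)
    (c := K b) (fun a => vmap K (J a) b).
Proof.
move=> d.
have mapE a : wcolim_map (W := vfun_comp (vcorepr B b) (vfun_op J))
    (F := vfun_comp K J) (c := K b) (fun a => vmap K (J a) b) d a =
    yoneda_map K b d (J a).
  by rewrite -[LHS]compm1 wcolim_mapE.
split.
  move=> a a'; rewrite !mapE.
  have := wedge_precomp (vfun_op J) (yoneda_wedge K b d) a a'.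
  by rewrite /= !compA.
move=> X q hq.
have [|p [hp [pJ pu]]] := hJ (F := vcorepr B b)
  (G := vfun_comp (vcorepr C d) (vfun_op K)) (q := q).
  by move=> a a'; have := hq a a'; rewrite /= !compA.
exists (yoneda_elt p); split=> [a | h hh].
  by rewrite mapE -yoneda_eltK // pJ.
(* The Yoneda images of [h] form a wedge over [B] extending [q], hence agree with [p]. *)
rewrite -(yoneda_mapK h) /yoneda_elt; congr (_ ∘ (_ ⊗m _) ∘ _).
symmetry; apply: (pu (fun x => yoneda_map K b d x ∘ h)) => [|a].
  by apply: wedge_comp; exact: yoneda_wedge.
by rewrite -hh mapE.
Qed.

End Dense.

Section Lan.
Variables (V : smcc) (OA OB : Set) (A : vcat V OA) (B : vcat V OB).
Variable J : vfun A B.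

Lemma wedge_idl : is_wedge (G := vfun_comp (vfun_id B) J) (fun a => vid B (J a)).
Proof. by move=> a a'; rewrite /= comp1m; exact: wedge_vid. Qed.

Definition vnat_idl : vnat J (vfun_comp (vfun_id B) J) :=
  VNat (wedge_vnat wedge_idl).

Lemma wcolim_eq OC (C : vcat V OC) (W : vfun (vop A) (vself V)) (F : vfun A C) c
    (mu nu : forall a, W a ⟶ vhom C (F a) c) :
  (forall a, mu a = nu a) -> is_wcolim mu -> is_wcolim nu.
Proof.
move=> e hmu d; apply: (is_end_iso (hmu d) (id_iso _)) => a.
by rewrite compm1 /wcolim_map e.
Qed.

(** [vfun_comp (vfun_id B) J] acts by [J] followed by an identity, so the wedge conditions agree by
    rewriting and not by computation. *)
Lemma wcolim_idl (W : vfun (vop A) (vself V)) c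
    (mu : forall a, W a ⟶ vhom B (J a) c) :
  is_wcolim (F := vfun_comp (vfun_id B) J) mu -> is_wcolim (F := J) mu.
Proof.
have e X d (q : forall a, X ⟶ ihom (W a) (vhom B (J a) d)) :
    is_wedge (F := W) (G := vfun_comp (vcorepr B d) (vfun_op J)) q <->
    is_wedge (F := W)
      (G := vfun_comp (vcorepr B d) (vfun_op (vfun_comp (vfun_id B) J))) q.
  by split=> h a a'; have := h a a'; rewrite /= comp1m.
move=> h d; have [hw hu] := h d; split; first exact: (proj2 (e _ _ _) hw).
by move=> X q /e; exact: hu.
Qed.

Lemma lan_unitE OC (C : vcat V OC) (F : vfun A C) (L : vfun B C)
    (eta : vnat F (vfun_comp L J)) b a :
  lan_unit eta b a = vmul (vmap L (J a) b) (eta a) ∘ runV _.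
Proof. by rewrite vmulE. Qed.

Lemma lan_unit_whisker OC OD (C : vcat V OC) (D : vcat V OD) (F : vfun A C)
    (L : vfun B C) (eta : vnat F (vfun_comp L J)) (K : vfun C D) b a :
  lan_unit (vwhisker K eta) b a = vmap K (F a) (L b) ∘ lan_unit eta b a.
Proof. by rewrite !lan_unitE -compA vmap_vmul. Qed.

Lemma vmap_ucomp O O' (C : vcat V O) (D : vcat V O') (K : vfun C D) x y z
    (s : unit ⟶ vhom C y z) (t : unit ⟶ vhom C x y) :
  vmap K x z ∘ ucomp s t = ucomp (vmap K y z ∘ s) (vmap K x y ∘ t).
Proof. by rewrite /ucomp -!vmulE -compA vmap_vmul. Qed.

Lemma extends_abs_vdense : extends_wedges (vfun_op J) (vself V) -> abs_vdense J.
Proof.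
move=> hJ.
have lanJ b : is_wcolim (W := vfun_comp (vcorepr B b) (vfun_op J)) (F := J)
    (c := b) (fun a => id_ (vhom B (J a) b)).
  by apply: wcolim_idl; exact: (extends_wcolim hJ (vfun_id B) b).
split.
  exists (vfun_id B), vnat_idl; split.
    move=> b; apply: (wcolim_eq _ (lanJ b)) => a.
    by rewrite lan_unitE vmul1r compA runVK compm1.
  exists (VNat (wedge_vnat (wedge_vid (vfun_id B)))) => b; exists (vid B b).
  by rewrite /ucomp -vmulE vmul1r compA lunV_unit runVK compm1.
move=> L eta heta K b.
(* For any left Kan extension [L] of [J] along itself, [L b] is isomorphic to [b] compatibly with
   the units, and [K] preserves this isomorphism. *)
have [t [s [st [ts e]]]] := wcolim_unique (lanJ b) (heta b).
apply: (wcolim_iso (t := vmap K b (L b) ∘ t) (s := vmap K (L b) b ∘ s)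
  _ _ _ (extends_wcolim hJ K b)).
- by rewrite -vmap_ucomp st vmap1.
- by rewrite -vmap_ucomp ts vmap1.
- by move=> a; rewrite lan_unit_whisker e -compA vmap_vmul compm1.
Qed.

End Lan.

(** * From absolute density to extension *)

(** The isomorphism [t] from [L] to the identity is absorbed into the unit: [e] is [eta] followed by
    [t] at [J a]. *)
Lemma dense_unit (V : smcc) (OA OB : Set) (A : vcat V OA) (B : vcat V OB)
    (J : vfun A B) :
  vdense J -> exists e : vnat J (vfun_comp (vfun_id B) J), is_lan e.
Proof.
move=> [L [eta [heta [t ht]]]].
have w := wedge_ucomp (wedge_precomp J (vnat_wedge t)) (vnat_wedge eta).
exists (VNat (wedge_vnat w)) => b; have [s [st ts]] := ht b.
apply: (wcolim_iso st ts _ (heta b)) => a; rewrite !lan_unitE vmul_ucomp.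
(* Naturality moves [t] from [J a] to [b], past the action of [L]. *)
have := vnt_nat t (J a) b; rewrite -!vmulE => /= <-.
rewrite -[in LHS](compm1 (eta a)) -[in LHS]vmul_tens vmulA !compA.
rewrite runVN (comp_eq1 (assoc_runV _ _)).
by rewrite -[in RHS](compm1 (t b)) -[in RHS]vmul_tens !compA.
Qed.

(** * Hom-objects of [B] as coends *)

Section Coend.
Variables (V : smcc) (OA OB : Set) (A : vcat V OA) (B : vcat V OB).
Variables (J : vfun A B) (e : vnat J (vfun_comp (vfun_id B) J)).

(* In elements: [g |-> g e_a]. *)
Definition twist a b : vhom B (J a) b ⟶ vhom B (J a) b := lan_unit e b a.

Lemma twist_comp a b X (f : X ⟶ vhom B (J a) b) :
  twist a b ∘ f = vmul f (e a) ∘ runV X.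
Proof.
by rewrite /twist lan_unitE compA -runVN -compA vmul_tens comp1m compm1.
Qed.

Lemma twist_vmul a b b' X Y (f : X ⟶ vhom B b b') (g : Y ⟶ vhom B (J a) b) :
  twist a b' ∘ vmul f g = vmul f (twist a b ∘ g).
Proof.
rewrite !twist_comp vmulA compA assoc_runV -{2}(compm1 f).
by rewrite vmul_tens.
Qed.

(** Naturality of [e]: [g (J u) e = g e (J u)]. *)
Lemma twist_vmulJ a a' b X (f : X ⟶ vhom B (J a) b) :
  twist a' b ∘ vmul f (vmap J a' a) = vmul (twist a b ∘ f) (vmap J a' a).
Proof.
rewrite !twist_comp vmulA compA assoc_runV vmul_tens compm1.
have := vnt_nat e a' a; rewrite -!vmulE /= comp1m => <-.
rewrite -[in LHS](compm1 f) -[in LHS]vmul_tens -assoc_runV_tens.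
by rewrite -compA -vmulA vmul_tens compm1.
Qed.

Hypothesis he : is_lan e.

(** In elements [s (g e) = g]: the identity wedge of the weight factors through the colimit [b]. *)
Lemma twist_retract b :
  exists s : unit ⟶ vhom B b b, forall a, vmul s (twist a b) = lun _.
Proof.
pose W := vfun_comp (vcorepr B b) (vfun_op J).
have [s [hs _]] := proj2 (he b b) unit _ (wedge_vid W).
exists s => a; have := hs a; rewrite wcolim_mapE /= => h.
by rewrite -[LHS]ev_curry h ev_curry.
Qed.

Hypothesis hK : forall b0, is_lan (vwhisker (vrepr B b0) e).

(* In elements: [(x, g, u) |-> (x, g e u)]. *)
Definition coend_map b0 b X a :
    (X ⊗ vhom B (J a) b) ⊗ vhom B b0 (J a) ⟶ X ⊗ vhom B b0 b :=
  locked_with vmul_key ((id_ X ⊗m vmul (twist a b) (id_ _)) ∘ assoc _ _ _).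

Lemma coend_mapE b0 b X a :
  coend_map b0 b X a = (id_ X ⊗m vmul (twist a b) (id_ _)) ∘ assoc _ _ _.
Proof. by rewrite /coend_map unlock. Qed.

Lemma ev_vrepr b0 x y X Y (f : X ⟶ vhom B x y) (g : Y ⟶ vhom B b0 x) :
  ev (vhom B b0 x) (vhom B b0 y) ∘ ((vmap (vrepr B b0) x y ∘ f) ⊗m g) = vmul f g.
Proof. by rewrite /= curryN ev_curry_t compA tens_comp comp1m compm1 vmulE. Qed.

Lemma coend_curry b0 b X (d : V) a (h : X ⟶ ihom (vhom B b0 b) d) :
  vmul (C := vself V) h (lan_unit (vwhisker (vrepr B b0) e) b a) =
  curry (ev _ _ ∘ (h ⊗m id_ _) ∘ coend_map b0 b X a).
Proof.
apply: ev_inj; rewrite ev_curry ev_vself lan_unit_whisker.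
have := ev_vrepr (b0 := b0) (twist a b) (id_ (vhom B b0 (J a))).
rewrite /twist coend_mapE => /= ->.
by rewrite !compA tens_compA comp1m compm1.
Qed.

(** The hypothesis is dinaturality, [Q (x, g (J u), v) = Q (x, g, (J u) v)]. Curried twice, [Q]
    becomes a wedge on the weight, and preservation by [vhom B b0 -] yields [P]. *)
Lemma coend_exists b0 b X (d : V)
    (Q : forall a, (X ⊗ vhom B (J a) b) ⊗ vhom B b0 (J a) ⟶ d) :
  (forall a a',
    Q a' ∘ (((id_ X ⊗m vmul (id_ _) (vmap J a' a)) ∘ assoc _ _ _) ⊗m id_ _) =
    Q a ∘ (id_ _ ⊗m vmul (vmap J a' a) (id_ _)) ∘ assoc _ _ _) ->
  exists P : X ⊗ vhom B b0 b ⟶ d, forall a, P ∘ coend_map b0 b X a = Q a.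
Proof.
move=> hQ.
pose K := vrepr B b0.
pose q a : X ⟶ ihom (vhom B (J a) b) (ihom (K (J a)) d) := curry (curry (Q a)).
have hq : is_wedge (F := vfun_comp (vcorepr B b) (vfun_op J))
    (G := vfun_comp (vcorepr (vself V) d) (vfun_op (vfun_comp K J))) q.
  apply: (proj2 (wedge_corepr (J := J) (F := vfun_comp K J) (C := vself V)
    (b := b) (d := d) q)) => a a'.
  rewrite !ev_curry; apply: ev_inj; rewrite ev_vself ev_curry_t.
  rewrite compA curryN ev_curry hQ; congr (_ ∘ (_ ⊗m _) ∘ _).
  symmetry; exact: (ev_vrepr (b0 := b0) (vmap J a' a) (id_ (vhom B b0 (J a')))).
have [h [hh _]] := proj2 (hK b0 b d) X q hq.
exists (ev _ _ ∘ (h ⊗m id_ _)) => a; have := hh a; rewrite wcolim_mapE.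
by rewrite coend_curry => /curry_inj/curry_inj.
Qed.

Lemma coend_ext b0 b X (d : V) (f g : X ⊗ vhom B b0 b ⟶ d) :
  (forall a, f ∘ coend_map b0 b X a = g ∘ coend_map b0 b X a) -> f = g.
Proof.
move=> h; rewrite -(ev_curry f) -(ev_curry g); congr (_ ∘ (_ ⊗m _)).
apply: (wcolim_ext (hK b0 b)) => a.
by rewrite !coend_curry !ev_curry h.
Qed.

(* Replacing [d] by [ihom Y d] allows a further factor [Y]. *)
Lemma coend_tens_ext b0 b X Y (d : V) (f g : (X ⊗ vhom B b0 b) ⊗ Y ⟶ d) :
  (forall a, f ∘ (coend_map b0 b X a ⊗m id_ Y) =
             g ∘ (coend_map b0 b X a ⊗m id_ Y)) -> f = g.
Proof.
move=> h; rewrite -(ev_curry f) -(ev_curry g); congr (_ ∘ (_ ⊗m _)).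
by apply: coend_ext => a; rewrite !curryN h.
Qed.

(** Associativity: [h (g e u) = (h g) e u]. *)
Lemma coend_map_vmull b0 b b' X a :
  (id_ X ⊗m vcomp b0 b b') ∘ assoc X (vhom B b b') (vhom B b0 b)
    ∘ coend_map b0 b (X ⊗ vhom B b b') a =
  coend_map b0 b' X a ∘ (((id_ X ⊗m vcomp (J a) b b') ∘ assoc _ _ _) ⊗m id_ _).
Proof.
rewrite !coend_mapE -(tensm1 X (vhom B b b')) tensm_compl.
rewrite !compA (comp_eq (assocN _ _ _)) pentagon.
rewrite (comp_eq (assocN _ _ _)) !compA !tens_compA !comp1m.
congr (_ ⊗m _ ∘ _).
rewrite -(vmul_id B (J a) b b') vmul_tens twist_vmul !comp1m !compm1.
by rewrite vmulA -vmulE.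
Qed.

(** Associativity: [(g e u) v = g e (u v)]. *)
Lemma coend_map_vmulr b0 b0' b X a :
  (id_ X ⊗m vcomp b0' b0 b) ∘ assoc X (vhom B b0 b) (vhom B b0' b0)
    ∘ (coend_map b0 b X a ⊗m id_ _) =
  coend_map b0' b X a ∘ (id_ _ ⊗m vcomp b0' b0 (J a)) ∘ assoc _ _ _.
Proof.
rewrite !coend_mapE -(tensm1 X (vhom B (J a) b)) tensm_compl.
rewrite !compA !(comp_eq (assocN _ _ _)) pentagon !compA !tens_compA !comp1m.
congr (_ ⊗m _ ∘ _).
by rewrite vmul_tens comp1m compm1 -vmulE vmulA vmul_id.
Qed.

Lemma coend_mapN b0 b X X' (f : X ⟶ X') a :
  (f ⊗m id_ _) ∘ coend_map b0 b X a = coend_map b0 b X' a ∘ ((f ⊗m id_ _) ⊗m id_ _).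
Proof.
rewrite !coend_mapE compA assocN tensm1 -!compA !tens_comp.
by rewrite !comp1m !compm1.
Qed.

Lemma coend_map_assoc b0 b X Y a :
  assoc Y X (vhom B b0 b) ∘ coend_map b0 b (Y ⊗ X) a =
  (id_ Y ⊗m coend_map b0 b X a) ∘ assoc _ _ _ ∘ (assoc _ _ _ ⊗m id_ _).
Proof.
rewrite !coend_mapE -(tensm1 Y X) (comp_eq (assocN _ _ _)) pentagon.
by rewrite tensm_compr !compA.
Qed.

(** * Extension of a V-natural family from [A] to [B] *)

Variables (OC : Type) (C : vcat V OC) (F G : vfun B C) (X : V).
Variable q : forall a, X ⟶ vhom C (F (J a)) (G (J a)).
Hypothesis hq : is_wedge (F := vfun_comp F J) (G := vfun_comp G J) q.

(* In elements: [(x, g) |-> G (g e) (q_a x)]. *)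
Definition ext_left a b : X ⊗ vhom B (J a) b ⟶ vhom C (F (J a)) (G b) :=
  locked_with vmul_key
    (vmul (vmap G (J a) b ∘ twist a b) (q a) ∘ sym X (vhom B (J a) b)).

Lemma ext_leftE a b :
  ext_left a b = vmul (vmap G (J a) b ∘ twist a b) (q a) ∘ sym X (vhom B (J a) b).
Proof. by rewrite /ext_left unlock. Qed.

Lemma ext_left_vmul a b b' :
  ext_left a b' ∘ (id_ X ⊗m vcomp (J a) b b') ∘ assoc _ _ _ =
  vmul (vmap G b b') (ext_left a b) ∘ assoc _ _ _ ∘ (sym X (vhom B b b') ⊗m id_ _).
Proof.
rewrite !ext_leftE -vmul_id !compA (comp_eq (symN _ _)).
rewrite (comp_eq1 (vmul_tens _ _ _ _)) compm1 compA twist_vmul vmap_vmul.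
rewrite !compm1 vmulA !compA.
have := hexagon X (vhom B b b') (vhom B (J a) b); rewrite !compA => ->.
by rewrite (comp_eq1 (vmul_tens _ _ _ _)) compm1.
Qed.

(** Naturality of [e], then of [q]: [G (g (J u) e) (q x) = G (g e) G (J u) (q x) = G (g e) (q x) F
    (J u)]. *)
Lemma ext_left_vmulJ a a' b :
  ext_left a' b ∘ (id_ X ⊗m vmul (id_ (vhom B (J a) b)) (vmap J a' a))
    ∘ assoc _ _ _ =
  vmul (ext_left a b) (vmap F (J a') (J a) ∘ vmap J a' a).
Proof.
rewrite !ext_leftE !compA (comp_eq (symN _ _)) (comp_eq1 (vmul_tens _ _ _ _)).
rewrite compm1 compA twist_vmulJ vmap_vmul !compm1 vmulA !compA.
have := hexagon X (vhom B (J a) b) (vhom A a' a); rewrite !compA => ->.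
have /is_wedgeE /(_ a' a) /= hw := hq.
rewrite (comp_eq1 (vmul_tens _ _ _ _)) -hw compm1.
by rewrite -[in RHS](compm1 (vmap F _ _ ∘ _)) -[in RHS]vmul_tens vmulA compA.
Qed.

Lemma ext_exists b0 b :
  exists P : X ⊗ vhom B b0 b ⟶ vhom C (F b0) (G b),
    forall a, P ∘ coend_map b0 b X a = vmul (ext_left a b) (vmap F b0 (J a)).
Proof.
apply: coend_exists => a a'.
rewrite vmul_tens -[ext_left _ _ ∘ _]compA ext_left_vmulJ compm1 vmulA.
by rewrite vmul_tens compm1 vmap_vmul compm1.
Qed.

(** Naturality of [p] gives [p x (F (g e)) (F u) = G (g e) (q x) (F u)], the values that determine
    [ext_map]. *)
Lemma ext_unique p b0 b :
  is_wedge (F := F) (G := G) p -> (forall a, p (J a) = q a) ->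
  forall a, vmul (p b) (vmap F b0 b) ∘ coend_map b0 b X a =
    vmul (ext_left a b) (vmap F b0 (J a)).
Proof.
move=> /is_wedgeE hp pJ a; rewrite coend_mapE (comp_eq1 (vmul_tens _ _ _ _)).
rewrite compm1 vmap_vmul compm1 -vmulA; congr vmul.
by rewrite -[p b]compm1 -vmul_tens hp pJ compA symN -compA vmul_tens compm1
  ext_leftE.
Qed.

Definition ext_map b0 b : X ⊗ vhom B b0 b ⟶ vhom C (F b0) (G b) :=
  proj1_sig (constructive_indefinite_description _ (ext_exists b0 b)).

Lemma ext_mapE b0 b a :
  ext_map b0 b ∘ coend_map b0 b X a = vmul (ext_left a b) (vmap F b0 (J a)).
Proof. by rewrite /ext_map; case: constructive_indefinite_description. Qed.

(** In elements [P (x, h v) = G h (P (x, v))]; by [coend_ext] it is enough to take [v = g e u]. *)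
Lemma ext_map_vmull b0 b b' :
  ext_map b0 b' ∘ (id_ X ⊗m vcomp b0 b b') ∘ assoc _ _ _ =
  vmul (vmap G b b') (ext_map b0 b) ∘ assoc _ _ _ ∘ (sym X (vhom B b b') ⊗m id_ _).
Proof.
apply: coend_ext => a.
have := coend_map_vmull b0 b b' X a; rewrite !compA => ->.
rewrite (comp_eq1 (ext_mapE _ _ _)) vmul_tens.
have := ext_left_vmul a b b'; rewrite !compA => ->.
rewrite coend_mapN (comp_eq1 (coend_map_assoc _ _ _ _ _)) !compA.
rewrite (comp_eq1 (vmul_tens _ _ _ _)) ext_mapE compm1 tens_comp comp1m.
by rewrite -[in LHS](compm1 (vmap F _ _)) -[in LHS]vmul_tens vmulA compA compm1.
Qed.

(** In elements [P (x, v w) = P (x, v) (F w)], again checked on [v = g e u]. *)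
Lemma ext_map_vmulr b0 b0' b :
  ext_map b0' b ∘ (id_ X ⊗m vcomp b0' b0 b) ∘ assoc _ _ _ =
  vmul (ext_map b0 b) (vmap F b0' b0).
Proof.
apply: coend_tens_ext => a.
have := coend_map_vmulr b0 b0' b X a; rewrite !compA => ->.
rewrite (comp_eq1 (ext_mapE _ _ _)) !vmul_tens ext_mapE compm1.
by rewrite (comp_eq1 (vmul_tens _ _ _ _)) compm1 vmulA -vmul_id vmap_vmul !compm1.
Qed.

Definition ext_at b : X ⟶ vhom C (F b) (G b) := ext_map b b ∘ insr X (vid B b).

Lemma ext_map_atl b0 b : ext_map b0 b = vmul (vmap G b0 b) (ext_at b0) ∘ sym X _.
Proof.
(* Taking [v = 1] in [P (x, h v) = G h (P (x, v))]. *)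
have := f_equal (fun k => k ∘ insr _ (vid B b0)) (ext_map_vmull b0 b0 b).
have cI : vcomp b0 b0 b ∘ insr _ (vid B b0) = id_ _.
  by rewrite /insr (comp_eq1 (vcompm1 _ _ _)) runVK.
rewrite /= !compA assoc_insr tens_comp cI comp1m tensm1 compm1 => ->.
rewrite insrN (comp_eq1 (assoc_insr _ _ _)) (comp_eq1 (vmul_tens _ _ _ _)).
by rewrite compm1.
Qed.

Lemma ext_map_atr b0 b : ext_map b0 b = vmul (ext_at b) (vmap F b0 b).
Proof.
rewrite -[vmap F b0 b]compm1 -vmul_tens -ext_map_vmulr.
rewrite !compA assoc_insr_tens tens_comp.
by rewrite (comp_eq1 (vcomp1m _ _ _)) lunVK comp1m tensm1 compm1.
Qed.

(** [P (x, g)] is both [P (x, 1) (F g)] and [G g (P (x, 1))]. *)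
Lemma ext_at_wedge : is_wedge ext_at.
Proof. by apply/is_wedgeE => b b'; rewrite -ext_map_atr ext_map_atl. Qed.

Lemma ext_map_twist a b :
  ext_map (J a) b ∘ (id_ X ⊗m twist a b) = ext_left a b.
Proof.
have := f_equal (fun k => k ∘ insr _ (vid B (J a))) (ext_mapE (J a) b a).
rewrite /= vmul_insr vmap1 vmul1r !compA runVK compm1 => <-.
rewrite coend_mapE compA assoc_insr tens_comp comp1m vmul_insr comp1m vmul1r.
by rewrite compA runVK compm1.
Qed.

Lemma vmul_retract_inj (x y z : OC) Y (s : unit ⟶ vhom C z y)
    (u : unit ⟶ vhom C y z) (f g : Y ⟶ vhom C x y) :
  vmul s u = vid C y ∘ lun unit -> vmul u f = vmul u g -> f = g.
Proof.
move=> su h; apply: (iso_epi (i := lun Y ∘ (lun unit ⊗m id_ Y))).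
  apply: iso_comp; first exact: lun_iso.
  by apply: tens_iso; [exact: lun_iso | exact: id_iso].
have eq k : k ∘ (lun Y ∘ (lun unit ⊗m id_ Y)) = vmul s (vmul u k) ∘ assoc _ _ _.
  by rewrite -vmulA su -{2}(compm1 k) -vmul_tens vmul1l compA.
by rewrite !eq h.
Qed.

Lemma ext_at_J a : ext_at (J a) = q a.
Proof.
have [s hs] := twist_retract (J a).
(* [twist] at the identity is [e a]; its left inverse [s] lets [G e] be cancelled from
   [G e (P (x, 1)) = G e (q x)]. *)
apply: (vmul_retract_inj (s := vmap G _ _ ∘ s)
  (u := vmap G (J a) (J a) ∘ (twist a (J a) ∘ vid B (J a)))).
  rewrite -vmap_vmul -(compm1 s) -vmul_tens hs lunN.
  by rewrite (comp_eq1 (vmap1 _ _)).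
have h := ext_map_twist a (J a).
rewrite ext_map_atl ext_leftE compA symN -compA vmul_tens compm1 in h.
have sI : is_iso (sym X (vhom B (J a) (J a))) by exists (sym _ _); rewrite !symK.
have := f_equal (fun k => k ∘ (vid B (J a) ⊗m id_ X)) (iso_epi sI h).
by rewrite /= !vmul_tens !compm1 !compA.
Qed.

Lemma ext_at_unique (p : forall b, X ⟶ vhom C (F b) (G b)) :
  is_wedge p -> (forall a, p (J a) = q a) -> forall b, p b = ext_at b.
Proof.
move=> hp pJ b; rewrite /ext_at.
have <- : vmul (p b) (vmap F b b) = ext_map b b.
  by apply: coend_ext => a; rewrite ext_mapE ext_unique.
by rewrite vmul_insr vmap1 vmul1r compA runVK compm1.
Qed.

End Coend.

Lemma abs_vdense_extends (V : smcc) (OA OB : Set) (A : vcat V OA) (B : vcat V OB)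
    (J : vfun A B) OC (C : vcat V OC) : abs_vdense J -> extends_wedges J C.
Proof.
move=> [/dense_unit [e he] hJ] F G X q hq.
(* Absolute density concerns every left Kan extension of [J] along itself, in particular the
   identity with unit [e]. *)
have hK b0 : is_lan (vwhisker (vrepr B b0) e) by exact: hJ.
exists (ext_at hK hq); split; first exact: ext_at_wedge.
split; first exact: ext_at_J.
exact: ext_at_unique.
Qed.

Theorem theorem5p11 (V : smcc) (hV : complete (base V))
    (hV' : cocomplete (base V)) (OA OB : Set) (A : vcat V OA) (B : vcat V OB)
    (J : vfun A B) :
  (vlax_epi hV J <-> abs_vdense J) /\ (abs_vdense J <-> abs_vcodense J).
Proof.
(* General in [J'] because the codense half applies it to [vfun_op J]. *)
have dense_large (OA' OB' : Set) (A' : vcat V OA') (B' : vcat V OB')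
    (J' : vfun A' B') :
    abs_vdense J' <-> forall (OC : Set) (C : vcat V OC), extends_wedges J' C.
  split=> [h OC C | h]; first exact: abs_vdense_extends.
  (* Extension of the opposite into [V] comes from extension of [J'] into the large
     [vop (vself V)]. *)
  apply: extends_abs_vdense; apply: extends_wedges_op.
  exact: extends_wedges_large.
split; first by rewrite vlax_epiE dense_large.
rewrite /abs_vcodense !dense_large; split=> h OC C.
  exact: extends_wedges_op.
exact: extends_wedges_unop.
Qed.
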